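(* Let $T$ be the Shapley operator of a concurrent unichain game with $n$ states, let $\epsilon\in(0,1)$, $\theta=p_{\min}/(1+p_{\min})$, $T_\theta=\theta I+(1-\theta)T$, let $k=k_{\mathrm{uni}}$ be the unichain index of the game, and $\|r\|_\infty=\max_{i,a,b}|r_i^{a,b}|$. Apply the algorithm RVI (described in the context) to the operator $T_\theta$, with requested precision $\epsilon'=(1-\theta)\epsilon$ and with an oracle for $T_\theta$ of accuracy $\eta>0$ satisfying $\eta\,(12+24\,k\,\theta^{-k})\le\epsilon'$. Then the algorithm provides an $\epsilon$-approximation of the value of the game (namely the interval $(1-\theta)^{-1}[\alpha-\epsilon'/3,\beta+\epsilon'/3]$ obtained from its output $(x,\alpha,\beta)$ contains the value of the game and has width at most $\epsilon$) in at most $$\bigl(|\log\epsilon|+|\log(1-\theta)|+\log 12+\log\|r\|_\infty\bigr)\,k_{\mathrm{uni}}\,\theta^{-k_{\mathrm{uni}}}$$ iterations.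
   Context: Notation: $[n]=\{1,\dots,n\}$; $e$ is the all-ones vector; $\mathbf t(x)=\max_i x_i$, $\mathbf b(x)=\min_i x_i$, $\|x\|_{\mathrm H}=\mathbf t(x)-\mathbf b(x)$ (Hilbert's seminorm). Concurrent game: the state space is $[n]$. For each state $i$ there are nonempty compact action sets $A(i)$ (player Min) and $B(i)$ (player Max), and for each $(a,b)\in A(i)\times B(i)$ a payment $r_i^{a,b}\in\mathbb{R}$ and a stochastic vector $P_i^{a,b}=(P_{ij}^{a,b})_{j\in[n]}$, all depending continuously on $(a,b)$. Let $\Delta_{A(i)},\Delta_{B(i)}$ be the sets of probability measures on $A(i),B(i)$, and put $r_i^{\alpha_i,\beta_i}=\int r_i^{a,b}\,d\alpha_i(a)d\beta_i(b)$, $P_{ij}^{\alpha_i,\beta_i}=\int P_{ij}^{a,b}\,d\alpha_i(a)d\beta_i(b)$. The Shapley operator is $T_i(v)=\min_{\alpha_i\in\Delta_{A(i)}}\max_{\beta_i\in\Delta_{B(i)}}\big(r_i^{\alpha_i,\beta_i}+\sum_{j}P_{ij}^{\alpha_i,\beta_i}v_j\big)$. Mean-payoff game and value: at each stage $k\ge 0$, in state $i_k$, knowing the history (all past states and actions, and $i_k$), Min and Max simultaneously and independently draw actions $a_k\in A(i_k)$, $b_k\in B(i_k)$; Min pays $r_{i_k}^{a_k,b_k}$ to Max and the next state is $j$ with probability $P_{i_kj}^{a_kb_k}$. A strategy $\sigma$ of Min (resp. $\tau$ of Max) assigns measurably to each history a probability measure on $A(i_k)$ (resp. $B(i_k)$).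 Let $J^N_{i_0}(\sigma,\tau)$ be the expectation of $\sum_{k=0}^{N-1}r_{i_k}^{a_k,b_k}$ from initial state $i_0$, $\chi^+_{i_0}(\sigma,\tau)=\limsup_N J^N_{i_0}(\sigma,\tau)/N$, $\chi^-_{i_0}(\sigma,\tau)=\liminf_N J^N_{i_0}(\sigma,\tau)/N$. The game has value $\chi^*\in\mathbb{R}^n$ if for all $\delta>0$ there are strategies $\sigma^\delta,\tau^\delta$ with $-\delta e+\chi^+(\sigma^\delta,\tau)\le\chi^*\le\chi^-(\sigma,\tau^\delta)+\delta e$ for all strategies $\sigma,\tau$. For a unichain game the value exists and is the same for all initial states, $\chi^*=\lambda e$; ''the value'' means the scalar $\lambda$. Pure policies: maps $\sigma,\tau$ with $\sigma(i)\in A(i)$, $\tau(i)\in B(i)$. $P^{\sigma,\tau}=(P_{ij}^{\sigma(i),\tau(i)})_{i,j}$. A nonnegative matrix is unichain if its digraph (arc $i\to j$ iff entry $ij$ is positive) has a unique final strongly connected component (final: any path starting in it stays in it). The game is unichain if every $P^{\sigma,\tau}$, for pure policies $\sigma,\tau$, is unichain. $p_{\min}=\min\{P_{ij}^{a,b}: i\ne j,\ (a,b)\in A(i)\times B(i),\ P_{ij}^{a,b}>0\}$ (presupposed to exist), $Q^{\sigma,\tau}=\theta I+(1-\theta)P^{\sigma,\tau}$. The unichain index $k_{\mathrm{uni}}$ is the smallest integer $k$ such that for all $i_1,i_2\in[n]$ and all sequences $(\sigma_1,\tau_1),\dots,(\sigma_k,\tau_k)$ of pairs of pure policies, rows $i_1$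 and $i_2$ of $Q^{\sigma_1,\tau_1}\cdots Q^{\sigma_k,\tau_k}$ have a common column in which both are positive (such $k\le n$ exists). Algorithm RVI (relative value iteration in approximate arithmetic), applied to an operator $S:\mathbb{R}^n\to\mathbb{R}^n$, with requested precision $\epsilon'>0$ and an oracle $\tilde S$ of accuracy $\eta\le\epsilon'/3$, i.e. $\|\tilde S(x)-S(x)\|_\infty\le\eta$ for all $x$: start from $x:=0$; repeat $x:=\tilde S(x)-\mathbf t(\tilde S(x))e$ until $\|x-\tilde S(x)\|_{\mathrm H}\le\epsilon'/3$; then return $x$, $\alpha:=\mathbf b(\tilde S(x)-x)$, $\beta:=\mathbf t(\tilde S(x)-x)$. An iteration is one execution of the body of the loop.
   Formalization: The iteration bound is read as the maximum of 1 and the displayed expression, since the loop always executes at least once while the expression can be below 1 (even negative) for small ‖r‖∞; for ‖r‖∞ = 0, log 0 is read as 0. *)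

(* Defs.v *)
From HB Require Import structures.
From mathcomp Require Import all_boot all_order all_algebra.
From mathcomp Require Import all_classical all_reals all_analysis.

Set Implicit Arguments.
Unset Strict Implicit.
Unset Printing Implicit Defensive.

Import Order.TTheory GRing.Theory Num.Theory.
Import numFieldNormedType.Exports.

Local Open Scope classical_set_scope.
Local Open Scope ring_scope.

HB.instance Definition _ (n : nat) := isPointed.Build 'I_n.+1 ord0.
HB.instance Definition _ (n : nat) := @isMeasurable.Build
  default_measure_display 'I_n.+1 discrete_measurable discrete_measurable0
  discrete_measurableC discrete_measurableU.

Definition borel (X : ptopologicalType) := g_sigma_algebraType (@open X).

(* Vectors are columns indexed by 'I_n.+1, so that maxima and minima of their
   entries make sense; [`|x|] is the library's sup-norm of matrices. *)
Definition top_entry (R : realType) (n : nat) (x : 'cV[R]_n.+1) : R :=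
  \big[Num.max/x ord0 0]_i x i 0.

Definition bot_entry (R : realType) (n : nat) (x : 'cV[R]_n.+1) : R :=
  \big[Num.min/x ord0 0]_i x i 0.

Definition hilbert_seminorm (R : realType) (n : nat) (x : 'cV[R]_n.+1) : R :=
  top_entry x - bot_entry x.

(* The action sets are compact subsets of one Hausdorff space per player. This
   is no restriction: finitely many compact Hausdorff spaces embed as compact
   subsets of their disjoint union. The values of [pay] and [trans] outside
   [actA i `*` actB i] are irrelevant. *)
Record concurrent_game (R : realType) (n : nat) (X Y : ptopologicalType) :=
  ConcurrentGame {
  actA : 'I_n.+1 -> set X ;
  actB : 'I_n.+1 -> set Y ;
  pay : 'I_n.+1 -> X -> Y -> R ;
  trans : 'I_n.+1 -> X -> Y -> 'I_n.+1 -> R ;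
  hausdorffA : hausdorff_space X ;
  hausdorffB : hausdorff_space Y ;
  actA_compact : forall i, compact (actA i) ;
  actB_compact : forall i, compact (actB i) ;
  actA_neq0 : forall i, actA i !=set0 ;
  actB_neq0 : forall i, actB i !=set0 ;
  pay_continuous : forall i,
    {within actA i `*` actB i, continuous (fun ab => pay i ab.1 ab.2)} ;
  trans_continuous : forall i j,
    {within actA i `*` actB i, continuous (fun ab => trans i ab.1 ab.2 j)} ;
  trans_ge0 : forall i a b j, actA i a -> actB i b -> 0 <= trans i a b j ;
  trans_sum1 : forall i a b, actA i a -> actB i b -> \sum_j trans i a b j = 1
}.

Section Game.
Context {R : realType} {n : nat} {X Y : ptopologicalType}.
Variable G : concurrent_game R n X Y.

Definition norm_pay : R :=
  sup [set c | exists i a b, [/\ actA G i a, actB G i b & c = `|pay G i a b|]].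

(* Borel probability measures on [A i] are encoded as Borel probability
   measures on the ambient space that give mass 1 to [A i]. *)
Definition mixedA (i : 'I_n.+1) : set (probability (borel X) R) :=
  [set alpha | alpha (actA G i) = 1%E].

Definition mixedB (i : 'I_n.+1) : set (probability (borel Y) R) :=
  [set beta | beta (actB G i) = 1%E].

Definition mixed_pay (i : 'I_n.+1) (alpha : probability (borel X) R)
    (beta : probability (borel Y) R) : R :=
  \int[(alpha \x beta)%E]_(ab in actA G i `*` actB G i) pay G i ab.1 ab.2.

Definition mixed_trans (i : 'I_n.+1) (alpha : probability (borel X) R)
    (beta : probability (borel Y) R) (j : 'I_n.+1) : R :=
  \int[(alpha \x beta)%E]_(ab in actA G i `*` actB G i) trans G i ab.1 ab.2 j.

(* The min and max over mixed actions are written as inf and sup of bounded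
   sets of reals; no attainment is assumed. *)
Definition shapley (v : 'cV[R]_n.+1) : 'cV[R]_n.+1 :=
  \col_i inf [set sup [set mixed_pay i alpha beta
                           + \sum_j mixed_trans i alpha beta j * v j 0
                      | beta in mixedB i]
             | alpha in mixedA i].

(* [(t, i)] is the history in which [t] lists the past triples
   (state, action of Min, action of Max) and [i] is the current state. *)
Definition history (k : nat) : Type :=
  (k.-tuple ('I_n.+1 * borel X * borel Y) * 'I_n.+1)%type.

Definition history_next (k : nat) (h : history k) (a : X) (b : Y)
    (j : 'I_n.+1) : history k.+1 :=
  ([tuple of rcons h.1 (h.2, a, b)], j).

Definition total_pay (k : nat) (h : history k) : R :=
  \sum_(s <- h.1) pay G s.1.1 s.1.2 s.2.

Record strategyA := StrategyA {
  stratA :> forall k, history k -> probability (borel X) R ;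
  stratA_measurable : forall k, measurable_fun [set: history k]
    (@stratA k : history k -> pprobability (borel X) R) ;
  stratA_mixed : forall k (h : history k), mixedA h.2 (stratA h)
}.

Record strategyB := StrategyB {
  stratB :> forall k, history k -> probability (borel Y) R ;
  stratB_measurable : forall k, measurable_fun [set: history k]
    (@stratB k : history k -> pprobability (borel Y) R) ;
  stratB_mixed : forall k (h : history k), mixedB h.2 (stratB h)
}.

(* Expectation of [f] under the law of the history at stage [k]: that law is
   the composition of the one-stage kernels, which, given the history [h], draw
   the actions from [sigma h] and [tau h] independently and then the next state
   from [trans]. The recursion integrates out the last stage first. *)
Fixpoint play_expectation (sigma : strategyA) (tau : strategyB) (i0 : 'I_n.+1)
    (k : nat) : (history k -> R) -> R :=
  match k with
  | 0%N => fun f => f ([tuple], i0)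
  | k'.+1 => fun f => play_expectation sigma tau i0 (fun h : history k' =>
      \int[(sigma k' h \x tau k' h)%E]_(ab in actA G h.2 `*` actB G h.2)
        \sum_j trans G h.2 ab.1 ab.2 j * f (history_next h ab.1 ab.2 j))
  end.

Definition expected_total (sigma : strategyA) (tau : strategyB)
    (i0 : 'I_n.+1) (N : nat) : R :=
  play_expectation sigma tau i0 (@total_pay N).

Definition chi_sup (sigma : strategyA) (tau : strategyB) (i0 : 'I_n.+1) :=
  limn_esup (fun N => (expected_total sigma tau i0 N / N%:R)%:E).

Definition chi_inf (sigma : strategyA) (tau : strategyB) (i0 : 'I_n.+1) :=
  limn_einf (fun N => (expected_total sigma tau i0 N / N%:R)%:E).

Definition has_value (chi : 'cV[R]_n.+1) : Prop :=
  forall delta : R, 0 < delta ->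
  exists (sigma_d : strategyA) (tau_d : strategyB),
  forall (sigma : strategyA) (tau : strategyB) (i : 'I_n.+1),
    (- delta%:E + chi_sup sigma_d tau i <= (chi i 0)%:E)%E /\
    ((chi i 0)%:E <= chi_inf sigma tau_d i + delta%:E)%E.

Definition policyA (sigma : 'I_n.+1 -> X) : Prop := forall i, actA G i (sigma i).

Definition policyB (tau : 'I_n.+1 -> Y) : Prop := forall i, actB G i (tau i).

Definition policy_matrix (sigma : 'I_n.+1 -> X) (tau : 'I_n.+1 -> Y) :
    'M[R]_n.+1 :=
  \matrix_(i, j) trans G i (sigma i) (tau i) j.

Definition lazy_matrix (theta : R) (sigma : 'I_n.+1 -> X)
    (tau : 'I_n.+1 -> Y) : 'M[R]_n.+1 :=
  theta%:M + (1 - theta) *: policy_matrix sigma tau.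

Definition pos_arc (M : 'M[R]_n.+1) : rel 'I_n.+1 := fun i j => 0 < M i j.

Definition is_scc (e : rel 'I_n.+1) (C : {set 'I_n.+1}) : Prop :=
  C != finset.set0 /\
  forall i j, i \in C -> (j \in C) = connect e i j && connect e j i.

Definition is_final (e : rel 'I_n.+1) (C : {set 'I_n.+1}) : Prop :=
  forall i j, i \in C -> connect e i j -> j \in C.

Definition unichain_matrix (M : 'M[R]_n.+1) : Prop :=
  exists! C : {set 'I_n.+1}, is_scc (pos_arc M) C /\ is_final (pos_arc M) C.

Definition unichain_game : Prop :=
  forall sigma tau, policyA sigma -> policyB tau ->
    unichain_matrix (policy_matrix sigma tau).

Definition positive_offdiag : set R :=
  [set p | 0 < p /\ exists i j a b,
     [/\ i != j, actA G i a, actB G i b & p = trans G i a b j]].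

Definition is_pmin (p : R) : Prop :=
  positive_offdiag p /\ forall q, positive_offdiag q -> p <= q.

Definition common_column (theta : R) (k : nat) : Prop :=
  forall (i1 i2 : 'I_n.+1)
    (sigma : 'I_k -> 'I_n.+1 -> X) (tau : 'I_k -> 'I_n.+1 -> Y),
    (forall l, policyA (sigma l)) -> (forall l, policyB (tau l)) ->
    let M := \prod_(l < k) lazy_matrix theta (sigma l) (tau l) in
    exists j, 0 < M i1 j /\ 0 < M i2 j.

Definition is_unichain_index (theta : R) (k : nat) : Prop :=
  common_column theta k /\ forall m, common_column theta m -> (k <= m)%N.

End Game.

Section RelativeValueIteration.
Context {R : realType} {n : nat}.
Variable S : 'cV[R]_n.+1 -> 'cV[R]_n.+1.

Definition rvi_iterate (m : nat) : 'cV[R]_n.+1 :=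
  iter m (fun x => S x - const_mx (top_entry (S x))) 0.

Definition rvi_stop (prec : R) (x : 'cV[R]_n.+1) : bool :=
  hilbert_seminorm (x - S x) <= prec / 3.

(* The run halts after exactly [N] executions of the loop body and returns
   [(x, alpha, beta)]; the test is made after each execution, so [0 < N]. *)
Definition rvi_returns (prec : R) (N : nat) (x : 'cV[R]_n.+1)
    (alpha beta : R) : Prop :=
  [/\ (0 < N)%N /\ x = rvi_iterate N,
      rvi_stop prec x,
      forall m, (0 < m < N)%N -> ~~ rvi_stop prec (rvi_iterate m),
      alpha = bot_entry (S x - x) &
      beta = top_entry (S x - x)].

End RelativeValueIteration.

(* Main.v *)
Require Import Defs.
From HB Require Import structures.
From mathcomp Require Import all_boot all_order all_algebra.
From mathcomp Require Import all_classical all_reals all_analysis.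
From mathcomp Require Import measurable_realfun ring lra.

(** Contraction. The Shapley operator changes between two points [x] and [y] by
    at most the expectation of [x - y] after one transition under suitable pure
    policies ([shapley_pure]). Hence the damped operator changes by at most a
    lazy matrix applied to [x - y], and its [k]-th iterate by at most a product
    of [k] lazy matrices; from below one has another such product. The unichain
    index provides a column that is positive in two given rows of one product,
    and merging policies while the reached sets are disjoint extends this to
    rows of two different products ([common_column_two_sequences]). Positive
    entries are at least [theta ^+ k], so the [k]-th iterate contracts Hilbert's
    seminorm by [1 - theta ^+ k] ([damped_contraction]).

    Value. Let lambda be the supremum over [x] of the smallest entry of
    [shapley x - x]. Comparing two points at a state where their difference is
    largest shows that lambda lies between the smallest and the largest entry of
    [shapley x - x] for every [x] ([escape_rate_bounds]). By contraction these
    two entries come arbitrarily close. At a point where they are close,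
    stationary play of near-optimal actions of the one-stage game gains about
    lambda per stage, whatever the opponent does
    ([has_value_of_approximate_shift]). For the maximizer these actions come
    from a minimax theorem up to an arbitrary error, obtained by discretizing
    one compact action set and applying Blackwell's approachability argument to
    the resulting finite vector of payoffs ([approximate_minimax]).

    Counting. Along the approximate iteration the oracle errors accumulate to
    at most a fixed point of the contraction recursion, so the residual is
    bounded by eta * (2 + 4 k theta^-k) plus a geometrically decaying multiple
    of the first increment ([rvi_residual]). The precision requirement makes
    the first part at most half of the stopping threshold. The second part fits
    in the other half after about (|ln epsilon| + ln 12 + ln |r|) theta^-k
    blocks of [k] steps; rounding this number up costs one block, which the
    term |ln (1 - theta)| pays for ([rounding_slack]). At the stopping time the
    increment of the oracle differs from that of the damped operator by at most
    [eta], so the returned interval contains lambda. *)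

Set Implicit Arguments.
Unset Strict Implicit.
Unset Printing Implicit Defensive.

Import Order.TTheory GRing.Theory Num.Theory.
Import numFieldNormedType.Exports.

Local Open Scope classical_set_scope.
Local Open Scope ring_scope.

(** * Extreme entries and Hilbert's seminorm *)

Section Seminorm.
Context {R : realType} {n : nat}.
Implicit Types (x y z : 'cV[R]_n.+1) (c : R).

Lemma le_top_entry x i : x i 0 <= top_entry x.
Proof. exact: (le_bigmax _ (fun i => x i 0)). Qed.

Lemma bot_entry_le x i : bot_entry x <= x i 0.
Proof. exact: (bigmin_le _ _ (fun i => x i 0)). Qed.

Lemma top_entry_attained x : exists i, x i 0 = top_entry x.
Proof.
have /bigmax_geP[xi|[i _ xi]] := lexx (top_entry x).
  by exists ord0; apply/eqP; rewrite eq_le le_top_entry xi.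
by exists i; apply/eqP; rewrite eq_le le_top_entry xi.
Qed.

Lemma bot_entry_attained x : exists i, x i 0 = bot_entry x.
Proof.
have /bigmin_leP[xi|[i _ xi]] := lexx (bot_entry x).
  by exists ord0; apply/eqP; rewrite eq_le bot_entry_le xi.
by exists i; apply/eqP; rewrite eq_le bot_entry_le xi.
Qed.

(** Estimates on the seminorm are proved and used one pair of entries at a
    time. *)
Lemma hilbert_leP x c :
  hilbert_seminorm x <= c <-> forall i j, x i 0 - x j 0 <= c.
Proof.
rewrite /hilbert_seminorm; split=> [xc i j|xc].
  by apply: le_trans xc; rewrite lerB ?le_top_entry ?bot_entry_le.
have [i <-] := top_entry_attained x; have [j <-] := bot_entry_attained x.
exact: xc.
Qed.

Lemma le_hilbert x i j : x i 0 - x j 0 <= hilbert_seminorm x.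
Proof. by have /hilbert_leP := lexx (hilbert_seminorm x). Qed.

Lemma hilbert_ge0 x : 0 <= hilbert_seminorm x.
Proof. by have := le_hilbert x ord0 ord0; rewrite subrr. Qed.

Lemma hilbertD x y :
  hilbert_seminorm (x + y) <= hilbert_seminorm x + hilbert_seminorm y.
Proof.
apply/hilbert_leP => i j; rewrite !mxE.
by have := le_hilbert x i j; have := le_hilbert y i j; lra.
Qed.

Lemma hilbertN x : hilbert_seminorm (- x) = hilbert_seminorm x.
Proof.
suff le y : hilbert_seminorm (- y) <= hilbert_seminorm y.
  by apply/eqP; rewrite eq_le le -{1}[x]opprK le.
by apply/hilbert_leP => i j; rewrite !mxE; have := le_hilbert y j i; lra.
Qed.

Lemma hilbertZ c x : 0 <= c ->
  hilbert_seminorm (c *: x) = c * hilbert_seminorm x.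
Proof.
move=> c0; apply/eqP; rewrite eq_le; apply/andP; split.
  by apply/hilbert_leP => i j; rewrite !mxE -mulrBr ler_wpM2l ?le_hilbert.
rewrite -[hilbert_seminorm x]/(top_entry x - bot_entry x).
have [i <-] := top_entry_attained x; have [j <-] := bot_entry_attained x.
by have := le_hilbert (c *: x) i j; rewrite !mxE -mulrBr.
Qed.

Lemma hilbert0 : hilbert_seminorm (0 : 'cV[R]_n.+1) = 0.
Proof. by rewrite -(scale0r (0 : 'cV[R]_n.+1)) hilbertZ// mul0r. Qed.

Lemma hilbert_shift c x :
  hilbert_seminorm (x - const_mx c) = hilbert_seminorm x.
Proof.
apply/eqP; rewrite eq_le; apply/andP; split; apply/hilbert_leP => i j.
  by have := le_hilbert x i j; rewrite !mxE; lra.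
by have := le_hilbert (x - const_mx c) i j; rewrite !mxE; lra.
Qed.

Lemma entry_le_norm x i : `|x i 0| <= `|x|.
Proof.
have [->|xi0] := eqVneq (x i 0) 0; first by rewrite normr0.
by rewrite [leRHS]mx_normrE (le_bigmax _ (fun ij => `|x ij.1 ij.2|) (i, 0)).
Qed.

Lemma hilbert_le_norm x : hilbert_seminorm x <= 2 * `|x|.
Proof.
apply/hilbert_leP => i j; have := entry_le_norm x i; have := entry_le_norm x j.
by rewrite !ler_norml => /andP[? ?] /andP[? ?]; lra.
Qed.

End Seminorm.

(** * Relative value iteration for a seminorm contraction *)

Section ApproximateIteration.
Context {R : realType} {n : nat}.
Variables (S oracle : 'cV[R]_n.+1 -> 'cV[R]_n.+1) (gamma eta : R) (k : nat).
Local Notation q := hilbert_seminorm.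
Hypothesis S_nonexpansive : forall x y, q (S x - S y) <= q (x - y).
Hypothesis S_contraction :
  forall x y, q (iter k S x - iter k S y) <= gamma * q (x - y).
Hypothesis gamma01 : 0 <= gamma < 1.
Hypothesis k_gt0 : (0 < k)%N.
Hypothesis oracleP : forall x, `|oracle x - S x| <= eta.

Local Notation X := (rvi_iterate oracle).

Let eta_ge0 : 0 <= eta. Proof. exact: le_trans (oracleP 0). Qed.

Lemma iter_nonexpansive m x y : q (iter m S x - iter m S y) <= q (x - y).
Proof.
by elim: m => //= m IHm; apply: le_trans IHm; exact: S_nonexpansive.
Qed.

Lemma iter_contraction m x y :
  q (iter m S x - iter m S y) <= gamma ^+ (m %/ k) * q (x - y).
Proof.
case/andP: gamma01 => g0 _; rewrite {1 2}(divn_eq m k) addnC !iterD.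
apply: le_trans (iter_nonexpansive _ _ _) _.
elim: (m %/ k)%N => [|j IHj]; first by rewrite mul0n /= mul1r.
rewrite mulSn !iterD; apply: le_trans (S_contraction _ _) _.
by rewrite exprS -mulrA ler_wpM2l.
Qed.

Lemma rvi_step_error x : q (oracle x - S x) <= 2 * eta.
Proof.
by apply: le_trans (hilbert_le_norm _) _; rewrite ler_wpM2l.
Qed.

Lemma rvi_iterateS m : X m.+1 =
  oracle (X m) - const_mx (top_entry (oracle (X m))).
Proof. by []. Qed.

(** Subtracting the maximum entry does not change the seminorm, so up to
    constants the iterates are those of the oracle itself and drift away from
    the exact ones by at most [2 * eta] per step. *)
Lemma rvi_drift j m : q (X (j + m) - iter j S (X m)) <= 2 * eta * j%:R.
Proof.
elim: j => [|j IHj]; first by rewrite /= subrr hilbert0 mulr0.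
rewrite addSn rvi_iterateS addrAC hilbert_shift iterS.
set y := iter j S _ in IHj *; set x := X _ in IHj *.
have -> : oracle x - S y = (oracle x - S x) + (S x - S y).
  by rewrite addrA subrK.
apply: le_trans (hilbertD _ _) _.
have := rvi_step_error x; have := S_nonexpansive x y.
rewrite -[in j.+1%:R]addn1 natrD; lra.
Qed.

(** Over [k] steps the oracle adds at most [2 eta k], while the error already
    present is multiplied by [gamma]; the bound is the fixed point of this
    recursion. *)
Lemma rvi_tracking m : q (X m - iter m S 0) <= 2 * eta * k%:R / (1 - gamma).
Proof.
case/andP: gamma01 => g0 g1; have g1' : 0 < 1 - gamma by rewrite subr_gt0.
set E := (X in _ <= X).
have kE : 2 * eta * k%:R + gamma * E = E.
  by rewrite /E; field; rewrite lt0r_neq0.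
have eta2k : 0 <= 2 * eta * k%:R by rewrite !mulr_ge0.
have kleE : 2 * eta * k%:R <= E.
  rewrite /E ler_pdivlMr// mulrBr mulr1 gerBl; exact: mulr_ge0.
elim/ltn_ind: m => m IHm; have [mk|km] := ltnP m k.
  have := rvi_drift m 0; rewrite addn0 => /le_trans; apply.
  by apply: le_trans kleE; rewrite ler_wpM2l ?mulr_ge0// ler_nat ltnW.
have -> : m = (k + (m - k))%N by rewrite subnKC.
set m' := (m - k)%N.
have IH : q (X m' - iter m' S 0) <= E by apply: IHm;
  rewrite ltn_subrL k_gt0 (leq_trans k_gt0 km).
rewrite iterD; set y := iter m' S 0 in IH *.
have -> : X (k + m') - iter k S y =
    (X (k + m') - iter k S (X m')) + (iter k S (X m') - iter k S y).
  by rewrite addrA subrK.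
apply: le_trans (hilbertD _ _) _; rewrite -kE lerD ?rvi_drift//.
by apply: le_trans (S_contraction _ _) _; rewrite ler_wpM2l.
Qed.

(** The residual at [X m] is that of the exact iterate, which decays
    geometrically, up to twice the tracking error and one oracle error. *)
Lemma rvi_residual m :
  q (X m - oracle (X m)) <=
    eta * (2 + 4 * k%:R / (1 - gamma)) + gamma ^+ (m %/ k) * q (S 0).
Proof.
set x := X m; set y := iter m S 0.
have -> : x - oracle x =
    (x - y) + ((y - S y) + ((S y - S x) + (S x - oracle x))).
  by rewrite !addrA !subrK.
have := hilbertD (x - y) ((y - S y) + ((S y - S x) + (S x - oracle x))).
have := hilbertD (y - S y) ((S y - S x) + (S x - oracle x)).
have := hilbertD (S y - S x) (S x - oracle x).
have := rvi_tracking m; rewrite -/x -/y => xy.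
have := rvi_step_error x; rewrite -hilbertN opprB => err.
have := S_nonexpansive y x; rewrite -[X in _ <= X]hilbertN opprB => Sxy.
have := iter_contraction m 0 (S 0).
rewrite -[iter m S (S 0)]iterSr iterS -/y sub0r hilbertN.
have -> : eta * (2 + 4 * k%:R / (1 - gamma)) =
    2 * eta + 2 * (2 * eta * k%:R / (1 - gamma)) by ring.
lra.
Qed.

End ApproximateIteration.

(** * Products of lazy transition matrices *)

Section StochasticRows.
Context {R : realType} {n : nat}.

(** Doeblin's estimate: weight [w] is charged at the value on the column [c] and
    all the remaining weight at the maximum. *)
Lemma stochastic_average_le (p : 'I_n.+1 -> R) (z : 'cV[R]_n.+1) (t w : R) c :
  (forall l, 0 <= p l) -> \sum_l p l = 1 -> (forall l, z l 0 <= t) ->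
  w <= p c -> \sum_l p l * z l 0 <= w * z c 0 + (1 - w) * t.
Proof.
move=> p0 p1 zt wp.
have gap : w * (t - z c 0) <= \sum_l p l * (t - z l 0).
  rewrite (bigD1 c)//=; apply: ler_wpDr.
    by apply: sumr_ge0 => l _; rewrite mulr_ge0 ?subr_ge0.
  by rewrite ler_wpM2r ?subr_ge0.
have sumE : \sum_l p l * (t - z l 0) = t - \sum_l p l * z l 0.
  under eq_bigr do rewrite mulrBr.
  by rewrite sumrB -mulr_suml p1 mul1r.
by rewrite sumE in gap; lra.
Qed.

End StochasticRows.

Section LazyProducts.
Context {R : realType} {n : nat} {X Y : ptopologicalType}.
Variables (G : concurrent_game R n X Y) (theta : R).
Hypothesis theta01 : 0 < theta < 1.
Local Notation Q := (lazy_matrix G theta).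

(** Policies are indexed by all natural numbers so that a product can be
    extended or truncated without changing its sequence. *)
Definition lazy_product (sigma : nat -> 'I_n.+1 -> X)
    (tau : nat -> 'I_n.+1 -> Y) (m : nat) : 'M[R]_n.+1 :=
  \prod_(l < m) Q (sigma l) (tau l).

Lemma lazy_matrixE sigma tau i j :
  Q sigma tau i j =
    theta * (i == j)%:R + (1 - theta) * trans G i (sigma i) (tau i) j.
Proof. by rewrite !mxE mulr_natr. Qed.

Lemma lazy_matrix_ge0 sigma tau i j :
  policyA G sigma -> policyB G tau -> 0 <= Q sigma tau i j.
Proof.
move=> polA polB; case/andP: theta01 => th0 th1; rewrite lazy_matrixE.
rewrite addr_ge0//; first by rewrite mulr_ge0// ltW.
by rewrite mulr_ge0// ?trans_ge0// subr_ge0 ltW.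
Qed.

Lemma lazy_matrix_diag sigma tau i :
  policyA G sigma -> policyB G tau -> theta <= Q sigma tau i i.
Proof.
move=> polA polB; case/andP: theta01 => th0 th1;
  rewrite lazy_matrixE eqxx mulr1.
by rewrite lerDl mulr_ge0// ?trans_ge0// subr_ge0 ltW.
Qed.

Lemma lazy_matrix_sum1 sigma tau i :
  policyA G sigma -> policyB G tau -> \sum_j Q sigma tau i j = 1.
Proof.
move=> polA polB; under eq_bigr do rewrite lazy_matrixE.
rewrite big_split/= -!mulr_sumr trans_sum1// (bigD1 i)//= eqxx big1.
  by rewrite addr0 !mulr1 addrC subrK.
by move=> j ji; rewrite eq_sym (negbTE ji).
Qed.

Lemma mulmx_sqE (A B : 'M[R]_n.+1) i j : (A * B) i j = \sum_l A i l * B l j.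
Proof. by rewrite -mulmxE mxE. Qed.

Lemma lazy_productS sigma tau m :
  lazy_product sigma tau m.+1 =
  lazy_product sigma tau m * Q (sigma m) (tau m).
Proof. by rewrite /lazy_product big_ord_recr. Qed.

Section Sequence.
Variables (sigma : nat -> 'I_n.+1 -> X) (tau : nat -> 'I_n.+1 -> Y).
Hypothesis polA : forall l, policyA G (sigma l).
Hypothesis polB : forall l, policyB G (tau l).
Local Notation M := (lazy_product sigma tau).

Lemma lazy_product_ge0 m i j : 0 <= M m i j.
Proof.
elim: m j => [|m IHm] j; first by rewrite /lazy_product big_ord0 mxE ler0n.
rewrite lazy_productS mulmx_sqE sumr_ge0// => l _.
by rewrite mulr_ge0//; exact: lazy_matrix_ge0.
Qed.

Lemma lazy_product_sum1 m i : \sum_j M m i j = 1.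
Proof.
elim: m => [|m IHm].
  rewrite /lazy_product big_ord0 (bigD1 i)//= big1 ?mxE ?eqxx ?addr0//.
  by move=> j ji; rewrite mxE eq_sym (negbTE ji).
rewrite lazy_productS; under eq_bigr do rewrite mulmx_sqE.
rewrite exchange_big/= -[RHS]IHm; apply: eq_bigr => l _.
by rewrite -mulr_sumr lazy_matrix_sum1 ?mulr1.
Qed.

(** The diagonal of a lazy matrix is positive: the chain may stay where it
    is. *)
Lemma lazy_product_pos_stays m m' i j :
  (m <= m')%N -> 0 < M m i j -> 0 < M m' i j.
Proof.
move=> /subnK <-; elim: (m' - m)%N => // d IHd /IHd pos.
rewrite addSn lazy_productS mulmx_sqE (bigD1 j)//= ltr_wpDr//.
  by apply: sumr_ge0 => l _;
    rewrite mulr_ge0 ?lazy_product_ge0 ?lazy_matrix_ge0.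
by case/andP: theta01 => th0 _;
  rewrite mulr_gt0// (lt_le_trans th0)// lazy_matrix_diag.
Qed.

(** A positive entry of a product contains a path all of whose steps have
    probability at least [theta]. *)
Lemma lazy_product_pos_ge m i j :
  (forall s t i' j', policyA G s -> policyB G t ->
     0 < Q s t i' j' -> theta <= Q s t i' j') ->
  0 < M m i j -> theta ^+ m <= M m i j.
Proof.
case/andP: theta01 => th0 _ Qpos.
elim: m j => [|m IHm] j.
  by rewrite /lazy_product big_ord0 mxE; case: (i == j); rewrite ?ltxx ?lexx.
rewrite lazy_productS mulmx_sqE => pos.
have term0 l : 0 <= M m i l * Q (sigma m) (tau m) l j.
  by rewrite mulr_ge0 ?lazy_product_ge0 ?lazy_matrix_ge0.
have [l _ lpos] : exists2 l, true & 0 < M m i l * Q (sigma m) (tau m) l j.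
  apply/exists_inP; apply: contraLR pos => /exists_inPn no.
  rewrite -leNgt big1// => l _; apply/eqP.
  by rewrite eq_le term0 andbT leNgt no.
have Ml : 0 < M m i l.
  rewrite lt_neqAle lazy_product_ge0 andbT eq_sym.
  by apply: contraTneq lpos => ->; rewrite mul0r ltxx.
have Ql : 0 < Q (sigma m) (tau m) l j by rewrite -(pmulr_rgt0 _ Ml).
rewrite (bigD1 l)//= ler_wpDr ?sumr_ge0// exprSr.
by rewrite ler_pM ?exprn_ge0 ?(ltW th0)// ?IHm// Qpos.
Qed.

End Sequence.

(** The unichain index only speaks of two rows of one and the same product. Two
    different sequences can be merged into one as long as the states reached
    from [i1] under the first and from [i2] under the second are disjoint; once
    they meet, laziness keeps the meeting state reachable from both sides. *)
Lemma common_column_two_sequences k sigma tau sigma' tau' i1 i2 :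
  common_column G theta k ->
  (forall l, policyA G (sigma l)) -> (forall l, policyB G (tau l)) ->
  (forall l, policyA G (sigma' l)) -> (forall l, policyB G (tau' l)) ->
  exists j, 0 < lazy_product sigma tau k i1 j /\
            0 < lazy_product sigma' tau' k i2 j.
Proof.
move=> cc polA polB polA' polB'.
set M := lazy_product sigma tau; set M' := lazy_product sigma' tau'.
apply: contrapT => nocol.
have disjoint m l : (m <= k)%N -> 0 < M m i1 l -> 0 < M' m i2 l -> False.
  move=> mk Ml M'l; apply: nocol; exists l.
  by split; [exact: lazy_product_pos_stays Ml|exact: lazy_product_pos_stays
    M'l].
pose msigma l i := if 0 < M' l i2 i then sigma' l i else sigma l i.
pose mtau l i := if 0 < M' l i2 i then tau' l i else tau l i.
have mpolA l : policyA G (msigma l).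
  by move=> i; rewrite /msigma; case: ifP => _; [exact: polA'|exact: polA].
have mpolB l : policyB G (mtau l).
  by move=> i; rewrite /mtau; case: ifP => _; [exact: polB'|exact: polB].
have merged m : (m <= k)%N -> forall j,
    lazy_product msigma mtau m i1 j = M m i1 j /\
    lazy_product msigma mtau m i2 j = M' m i2 j.
  elim: m => [_ j|m IHm mk j]; first by rewrite /M /M' /lazy_product !big_ord0.
  have {}IHm := IHm (ltnW mk).
  rewrite /M /M' !lazy_productS !mulmx_sqE -/M -/M'.
  split; apply: eq_bigr => l _; have [N1 N2] := IHm l.
    rewrite N1; have [M0|M0] := ltP 0 (M m i1 l); last first.
      have -> : M m i1 l = 0 by apply/eqP; rewrite eq_le M0 lazy_product_ge0.
      by rewrite !mul0r.
    rewrite !lazy_matrixE /msigma /mtau; case: ifP => // M'0.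
    by have := disjoint m l (ltnW mk) M0 M'0.
  rewrite N2; have [M0|M0] := ltP 0 (M' m i2 l); last first.
    have -> : M' m i2 l = 0 by apply/eqP; rewrite eq_le M0 lazy_product_ge0.
    by rewrite !mul0r.
  by rewrite !lazy_matrixE /msigma /mtau M0.
have [j] := cc i1 i2 (fun l => msigma l) (fun l => mtau l)
  (fun l => mpolA l) (fun l => mpolB l).
rewrite -/(lazy_product msigma mtau k).
have [-> ->] := merged k (leqnn k) j.
by move=> [pos pos']; apply: nocol; exists j.
Qed.

(** The empty product is the identity, whose rows have disjoint supports. *)
Lemma common_column_gt0 k (i1 i2 : 'I_n.+1) :
  i1 != i2 -> common_column G theta k -> (0 < k)%N.
Proof.
case: k => // i12 cc.
have [sigma polA] : exists s, policyA G s.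
  by have /choice[s] := actA_neq0 G; exists s.
have [tau polB] : exists t, policyB G t.
  by have /choice[t] := actB_neq0 G; exists t.
have [j] := cc i1 i2 (fun=> sigma) (fun=> tau) (fun=> polA) (fun=> polB).
rewrite !big_ord0 !mxE; case: eqP => [<-|]; last by rewrite ltxx => _ [].
by rewrite eq_sym (negbTE i12) ltxx => -[].
Qed.

End LazyProducts.

(** An off-diagonal entry is [1 - theta] times a transition probability, a
    diagonal one contains [theta]; the choice of [theta] equalizes the two
    lower bounds, since [(1 - theta) * pmin = theta]. *)
Lemma pmin_lazy_matrix (R : realType) (n : nat) (X Y : ptopologicalType)
    (G : concurrent_game R n X Y) (pmin : R) (s : 'I_n.+1 -> X)
    (t : 'I_n.+1 -> Y) i j :
  let theta := pmin / (1 + pmin) in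
  is_pmin G pmin -> policyA G s -> policyB G t ->
  0 < lazy_matrix G theta s t i j -> theta <= lazy_matrix G theta s t i j.
Proof.
move=> theta [[p0 _] pmin_le] sA tB.
have p1 : 0 < 1 + pmin by rewrite addr_gt0.
have th0 : 0 < theta by rewrite divr_gt0.
have th1E : 1 - theta = (1 + pmin)^-1 by rewrite /theta; field;
  rewrite lt0r_neq0.
have th1 : theta < 1 by rewrite -subr_gt0 th1E invr_gt0.
have [->|ij] := eqVneq i j; first by rewrite lazy_matrix_diag ?th0.
rewrite lazy_matrixE (negbTE ij) mulr0 add0r th1E => pos.
rewrite /theta mulrC ler_pM2l ?invr_gt0//; apply: pmin_le.
split; last by exists i, j, (s i), (t i).
by rewrite -(pmulr_rgt0 _ (_ : 0 < (1 + pmin)^-1)) ?invr_gt0.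
Qed.

(** * Contraction and escape rate of the damped operator *)

Section DampedOperator.
Context {R : realType} {n : nat} {X Y : ptopologicalType}.
Variables (G : concurrent_game R n X Y) (theta : R) (k : nat).
Variable T : 'cV[R]_n.+1 -> 'cV[R]_n.+1.
Hypothesis theta01 : 0 < theta < 1.
Hypothesis T_pure : forall x y, exists sigma tau,
  [/\ policyA G sigma, policyB G tau &
    forall i, (T x - T y) i 0 <= (policy_matrix G sigma tau *m (x - y)) i 0].
Local Notation S := (fun x => theta *: x + (1 - theta) *: T x).
Local Notation q := hilbert_seminorm.

Lemma damped_pure x y : exists sigma tau,
  [/\ policyA G sigma, policyB G tau &
    forall i, (S x - S y) i 0 <=
      (lazy_matrix G theta sigma tau *m (x - y)) i 0].
Proof.
have [sigma [tau [polA polB le]]] := T_pure x y.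
exists sigma, tau; split => // i; case/andP: theta01 => th0 th1.
have -> : S x - S y = theta *: (x - y) + (1 - theta) *: (T x - T y).
  by rewrite !scalerBr addrACA opprD.
rewrite /lazy_matrix mulmxDl mul_scalar_mx -scalemxAl.
rewrite [leLHS]mxE [leRHS]mxE lerD2l [leLHS]mxE [leRHS]mxE.
by rewrite ler_wpM2l// subr_ge0 ltW.
Qed.

(** Iterating the comparison selects a new pair of pure policies at each step;
    the steps multiply since the matrices are nonnegative. Exchanging [x] and
    [y] gives a lower bound, with other policies. *)
Lemma damped_iter_pure m x y : exists sigma tau,
  [/\ forall l, policyA G (sigma l), forall l, policyB G (tau l) &
    forall i, (iter m S x - iter m S y) i 0 <=
              (lazy_product G theta sigma tau m *m (x - y)) i 0].
Proof.
elim: m => [|m [sigma [tau [polA polB le]]]].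
  have [sigma [tau [polA polB _]]] := T_pure x y.
  exists (fun=> sigma), (fun=> tau); split => // i.
  by rewrite /lazy_product big_ord0 mul1mx.
have [s [t [sA tB st]]] := damped_pure (iter m S x) (iter m S y).
exists (fun l => if l is l'.+1 then sigma l' else s).
exists (fun l => if l is l'.+1 then tau l' else t).
split=> [[]//|[]//|i]; rewrite /lazy_product big_ord_recl/=.
apply: le_trans (st i) _; rewrite -mulmxE -mulmxA [leLHS]mxE [leRHS]mxE.
by apply: ler_sum => l _; apply: ler_wpM2l; [exact: lazy_matrix_ge0|exact: le].
Qed.

(** The entries of the difference at [i1] and [i2] are bounded by two different
    products applied to [x - y]; a common weight [w] on one column makes these
    averages share the corresponding part of [x - y]. *)
Lemma damped_spread m w x y :
  (forall sigma tau sigma' tau' i1 i2,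
    (forall l, policyA G (sigma l)) -> (forall l, policyB G (tau l)) ->
    (forall l, policyA G (sigma' l)) -> (forall l, policyB G (tau' l)) ->
    exists j, w <= lazy_product G theta sigma tau m i1 j /\
              w <= lazy_product G theta sigma' tau' m i2 j) ->
  q (iter m S x - iter m S y) <= (1 - w) * q (x - y).
Proof.
move=> meet; apply/hilbert_leP => i1 i2.
have [sigma [tau [polA polB up]]] := damped_iter_pure m x y.
have [sigma' [tau' [polA' polB' lo]]] := damped_iter_pure m y x.
have [c [wM wM']] := meet _ _ _ _ i1 i2 polA polB polA' polB'.
have := stochastic_average_le (lazy_product_ge0 theta01 polA polB m i1)
  (lazy_product_sum1 theta polA polB m i1) (le_top_entry (x - y)) wM.
have yx l : (y - x) l 0 <= - bot_entry (x - y).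
  by rewrite lerNr; have := bot_entry_le (x - y) l; rewrite !mxE opprB.
have := stochastic_average_le (lazy_product_ge0 theta01 polA' polB' m i2)
  (lazy_product_sum1 theta polA' polB' m i2) yx wM'.
have := up i1; have := lo i2; rewrite /hilbert_seminorm.
rewrite [X in _ <= X -> _]mxE => loi2; rewrite [X in _ <= X -> _]mxE => upi1.
move/(le_trans loi2) => {}loi2; move/(le_trans upi1) => {}upi1.
have yxE l : (y - x) l 0 = - (x - y) l 0 by rewrite !mxE opprB.
have itE : (iter m S y - iter m S x) i2 0 = - (iter m S x - iter m S y) i2 0.
  by rewrite !mxE opprB.
move: loi2 upi1; rewrite yxE itE; lra.
Qed.

Lemma damped_nonexpansive x y : q (S x - S y) <= q (x - y).
Proof.
have := @damped_spread 1 0 x y; rewrite subr0 mul1r; apply => *.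
by exists ord0; rewrite !lazy_product_ge0.
Qed.

Lemma damped_contraction x y :
  (forall s t i j, policyA G s -> policyB G t ->
     0 < lazy_matrix G theta s t i j -> theta <= lazy_matrix G theta s t i j) ->
  common_column G theta k ->
  q (iter k S x - iter k S y) <= (1 - theta ^+ k) * q (x - y).
Proof.
move=> Qpos cc; apply: damped_spread => s t s' t' i1 i2 sA tB sA' tB'.
have [j [pos pos']] :=
  common_column_two_sequences theta01 i1 i2 cc sA tB sA' tB'.
by exists j; split; exact: lazy_product_pos_ge.
Qed.

Lemma pure_increment x y i : (T x - T y) i 0 <= top_entry (x - y).
Proof.
have [sigma [tau [polA polB le]]] := T_pure x y.
apply: le_trans (le i) _; rewrite mxE.
have P0 l : 0 <= policy_matrix G sigma tau i l.
  by rewrite mxE; exact: trans_ge0.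
have P1 : \sum_l policy_matrix G sigma tau i l = 1.
  by under eq_bigr do rewrite mxE; exact: trans_sum1.
have := stochastic_average_le P0 P1 (le_top_entry (x - y)) (P0 i).
by rewrite mul0r add0r subr0 mul1r.
Qed.

(** Compare at a state where [x - y] is largest: there [x] loses at most what
    [y] loses. *)
Lemma increments_cross x y : bot_entry (T x - x) <= top_entry (T y - y).
Proof.
have [i xyi] := top_entry_attained (x - y).
have := pure_increment x y i; rewrite -xyi.
have := bot_entry_le (T x - x) i; have := le_top_entry (T y - y) i.
by rewrite !mxE; lra.
Qed.

(** The candidate value: the best lower bound on the increment of the operator,
    which is squeezed between the extreme increments at every point. *)
Definition escape_rate : R := sup [set bot_entry (T x - x) | x in setT].

Lemma escape_rate_bounds x :
  bot_entry (T x - x) <= escape_rate <= top_entry (T x - x).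
Proof.
apply/andP; split.
  apply: ub_le_sup; last by exists x.
  by exists (top_entry (T x - x)) => _ [y _ <-]; exact: increments_cross.
by apply: ge_sup => [|_ [y _ <-]];
  [exists (bot_entry (T x - x)), x|exact: increments_cross].
Qed.

End DampedOperator.

(** * Payoffs on products of compact action sets *)

Section Integration.
Local Open Scope ereal_scope.
Context d (T : measurableType d) (R : realType)
  (mu : {measure set T -> \bar R}).

(** The integral of a nonnegative function is a supremum over the simple
    functions below it, so it is monotone on arbitrary functions; the
    signed case follows from positive and negative parts. *)
Lemma le_integral_pointwise (D : set T) (f g : T -> \bar R) :
  (forall x, D x -> f x <= g x) ->
  \int[mu]_(x in D) f x <= \int[mu]_(x in D) g x.
Proof.
move=> fg.
have fgD x : (f \_ D) x <= (g \_ D) x.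
  by rewrite /patch; case: ifPn => // /set_mem; exact: fg.
rewrite /integral; apply: leeB; apply: ereal_sup_le => _ [h hf <-].
  exists h => // x; apply: le_trans (hf x) _.
  by rewrite !funeposE ge_max !le_max fgD lexx orbT.
exists h => // x; apply: le_trans (hf x) _.
by rewrite !funenegE ge_max !le_max leeN2 fgD lexx orbT.
Qed.

Lemma le_Rintegral_pointwise (D : set T) (f g : T -> R) (c : R) :
  measurable D -> mu D = 1 ->
  (forall x, D x -> (- c <= f x)%R /\ (f x <= g x)%R /\ (g x <= c)%R) ->
  (\int[mu]_(x in D) f x <= \int[mu]_(x in D) g x)%R.
Proof.
move=> mD D1 fg.
have fin (h : T -> R) : (forall x, D x -> (- c <= h x <= c)%R) ->
    \int[mu]_(x in D) (h x)%:E \is a fin_num.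
  move=> hc; rewrite fin_numE -ltNye -ltey; apply/andP; split.
    apply: (@lt_le_trans _ _ (\int[mu]_(x in D) (- c)%:E)).
      by rewrite integral_cst// D1 mule1 ltNyr.
    by apply: le_integral_pointwise => x /hc /andP[]; rewrite lee_fin.
  apply: (@le_lt_trans _ _ (\int[mu]_(x in D) c%:E)).
    by apply: le_integral_pointwise => x /hc /andP[_]; rewrite lee_fin.
  by rewrite integral_cst// D1 mule1 ltry.
rewrite /Rintegral fine_le//.
- by apply: fin => x /fg[? [? ?]]; apply/andP; split; lra.
- by apply: fin => x /fg[? [? ?]]; apply/andP; split; lra.
- by apply: le_integral_pointwise => x /fg[_ [? _]]; rewrite lee_fin.
Qed.

(** Mixed actions with finite support. The formula is stated for nonnegative
    functions because that is the form in which Tonelli's theorem consumes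
    it. *)
Lemma finite_mixture m (p : 'I_m.+1 -> T) (w : 'I_m.+1 -> R) :
  (forall i, (0 <= w i)%R) -> (\sum_i w i = 1)%R ->
  exists P : probability T R,
    (forall D, measurable D -> (forall i, D (p i)) -> P D = 1) /\
    forall f : T -> \bar R, measurable_fun [set: T] f -> (forall x, 0 <= f x) ->
      \int[P]_x f x = \sum_i (w i)%:E * f (p i).
Proof.
move=> w0 w1.
pose nu := msum (fun l => mscale (NngNum (w0 (inord l))) \d_(p (inord l))) m.+1.
have nuE D : nu D = \sum_i (w i)%:E * \d_(p i) D.
  by rewrite /nu /msum; apply: eq_bigr => i _; rewrite /mscale/= inord_val.
have nuT D : (forall i, D (p i)) -> nu D = 1.
  move=> Dp; rewrite nuE -[RHS]/(1%:E) -w1 -sumEFin; apply: eq_bigr => i _.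
  by rewrite diracE mem_set// mule1.
pose P : probability T R := mnormalize nu (dirac (p ord0)).
have PE D : P D = nu D.
  have nu1 : nu setT = 1 by apply: nuT.
  have nuTE : fine (nu setT) = 1%R by rewrite nu1.
  have nuT01 : (nu setT == 0) || (nu setT == +oo) = false
    by rewrite nu1 onee_eq0.
  have -> : P D = mnormalize nu (dirac (p ord0)) D by [].
  by rewrite /mnormalize nuT01 nuTE invr1 mule1.
exists P; split=> [D _ Dp|f mf f0]; first by rewrite PE nuT.
rewrite (eq_measure_integral nu)//; last by move=> D _ _; exact: PE.
rewrite ge0_integral_measure_sum//; apply: eq_bigr => i _.
by rewrite ge0_integral_mscale//= integral_dirac//= diracT mul1e inord_val.
Qed.

End Integration.

Section CompactPayoff.
Context {R : realType} {X Y : ptopologicalType}.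
Variables (A : set X) (B : set Y) (F : X -> Y -> R).
Hypothesis hausX : hausdorff_space X.
Hypothesis hausY : hausdorff_space Y.
Hypothesis Acompact : compact A.
Hypothesis Bcompact : compact B.
Hypothesis Fcont : {within A `*` B, continuous (fun ab => F ab.1 ab.2)}.

Lemma compact_borel (Z : ptopologicalType) (K : set Z) :
  hausdorff_space Z -> compact K -> measurable (K : set (borel Z)).
Proof.
move=> hausZ /(compact_closed hausZ) Kcl; rewrite -[K]setCK; apply: measurableC.
by apply: sub_sigma_algebra; exact: closed_openC.
Qed.

Lemma payoff_near a b (e : R) : A a -> B b -> 0 < e ->
  \forall ab \near (a, b), A ab.1 -> B ab.2 -> `|F ab.1 ab.2 - F a b| < e.
Proof.
move=> Aa Bb e0; have /subspace_continuousP := Fcont.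
move=> /(_ (a, b) (conj Aa Bb)) /cvgrPdist_lt /(_ e e0) near.
have {}near : nbhs (a, b) (fun ab : X * Y => A ab.1 /\ B ab.2 ->
    `|F a b - F ab.1 ab.2| < e) := near.
by apply: filterS near => -[a' b']/= near Aa' Bb'; rewrite distrC; exact: near.
Qed.

(** Compactness of [B] makes the continuity in the first action uniform in the
    second one. *)
Lemma payoff_near_uniform a (e : R) : A a -> 0 < e ->
  \forall a' \near a, A a' -> forall b, B b -> `|F a' b - F a b| <= e.
Proof.
move=> Aa e0; have /compact_near_coveringP/near_covering_withinP := Bcompact.
move=> /(_ X (nbhs a) (fun a' b => A a' -> `|F a' b - F a b| <= e)) cover.
have /cover : forall b, B b ->
    \forall b' \near b & a' \near a, B b' -> A a' -> `|F a' b' - F a b'| <= e.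
  move=> b Bb; have e2 : 0 < e / 2 by rewrite divr_gt0.
  have [[U V]/= [Ua Vb] UV] := payoff_near Aa Bb e2.
  exists (V, U) => // -[b' a']/= [Vb' Ua'] Bb' Aa'.
  have := UV (a', b') (conj Ua' Vb') Aa' Bb'.
  have := UV (a, b') (conj (nbhs_singleton Ua) Vb') Aa Bb'.
  rewrite /= !ltr_norml ler_norml => /andP[? ?] /andP[? ?].
  by apply/andP; split; lra.
by apply: filterS => a' near Aa' b Bb; exact: near.
Qed.

(** The interior makes these sets open, so that compactness of [A] extracts a
    finite cover from them and they are Borel. *)
Definition close_actions (e : R) (a : X) : set X :=
  interior [set a' | A a' -> forall b, B b -> `|F a' b - F a b| <= e].

Lemma payoff_net (e : R) : 0 < e -> exists s : seq X,
  (forall a : X, a \in s -> A a) /\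
  (forall a, A a -> exists2 a' : X, a' \in s & close_actions e a' a).
Proof.
move=> e0; have := Acompact; rewrite compact_cover.
move=> /(_ X A (close_actions e)) [].
- by move=> a _; exact: open_interior.
- by move=> a Aa; exists a => //; exact: payoff_near_uniform.
move=> D DA cov; exists (finmap.enum_fset D);
  split=> [a /DA/set_mem//|a /cov[a' a'D ?]].
by exists a'.
Qed.

Lemma payoff_section_measurable a r : A a ->
  measurable (B `&` [set b | r < F a b] : set (borel Y)).
Proof.
move=> Aa; pose O := interior [set b | B b -> r < F a b].
have -> : B `&` [set b | r < F a b] = B `&` O.
  apply/seteqP; split=> b [Bb]; last by move=> /interior_subset Ob;
    split => //; exact: Ob.
  move=> /= rF; split => //.
  have rF0 : 0 < F a b - r by rewrite subr_gt0.
  have [[U V]/= [Ua Vb] UV] := payoff_near Aa Bb rF0.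
  apply: filterS Vb => b' Vb' Bb'.
  have := UV (a, b') (conj (nbhs_singleton Ua) Vb') Aa Bb'.
  by rewrite /= ltr_norml => /andP[? _]; lra.
apply: measurableI; first exact: compact_borel.
by apply: sub_sigma_algebra; exact: open_interior.
Qed.

(** The product of the two Borel algebras may be smaller than the Borel algebra
    of the product. The payoff is nevertheless measurable for it: on finitely
    many open sets of actions of the first player it is uniformly close to one
    of its sections, so its superlevel sets are countable unions of
    rectangles. *)
Lemma payoff_measurable :
  measurable_fun (A `*` B : set (borel X * borel Y)) (fun ab => F ab.1 ab.2).
Proof.
have /choice[D DP] : forall l : nat, exists s : seq X,
    (forall a : X, a \in s -> A a) /\
    (forall a, A a -> exists2 a' : X, a' \in s & close_actions l.+1%:R^-1 a' a).
  by move=> l; exact: payoff_net.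
move=> mAB; apply: (measurability _ (RGenOInfty.measurableE R)) => //.
move=> _ [_ [r ->] <-].
pose rect l a := (close_actions l.+1%:R^-1 a `&` A) `*`
  (B `&` [set b | r + l.+1%:R^-1 < F a b]).
have -> : (A `*` B) `&` (fun ab => F ab.1 ab.2) @^-1` `]r, +oo[ =
    \bigcup_l \bigcup_(a in [set` D l]) rect l a.
  apply/seteqP; split=> [[a b]/= [[Aa Bb]]|[a b] [l _ [a' /= a'D]]].
    rewrite in_itv/= andbT => rF.
    have rF0 : 0 < (F a b - r) / 2 by rewrite divr_gt0// subr_gt0.
    have [l _ /(_ l (leqnn l)) lP] := near_infty_natSinv_lt (PosNum rF0).
    have {}lP : l.+1%:R^-1 < (F a b - r) / 2 := lP;
      have [_ /(_ a Aa)[a' a'D a'a]] := DP l.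
    exists l => //; exists a' => //; split => //=; split => //.
    have := interior_subset a'a Aa b Bb; rewrite ler_norml => /andP[lo up].
    by move: lP lo up; rewrite /=; set del : R := l.+1%:R^-1; lra.
  move=> [/= [a'a Aa] [Bb rF]]; split => //; rewrite in_itv/= andbT.
  have := interior_subset a'a Aa b Bb; rewrite ler_norml => /andP[lo up].
  by move: rF lo up; rewrite /=; set del : R := l.+1%:R^-1; lra.
apply: bigcup_measurable => l _; apply: fin_bigcup_measurable => // a aD.
apply: measurableX.
  apply: measurableI; last exact: compact_borel.
  by apply: sub_sigma_algebra; exact: open_interior.
by apply: payoff_section_measurable; have [+ _] := DP l; exact.
Qed.

Lemma payoff_bounded : exists2 c : R, 0 < c &
  forall a b, A a -> B b -> `|F a b| <= c.
Proof.
have : bounded_set ((fun ab => F ab.1 ab.2) @` (A `*` B)).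
  by apply: compact_bounded; apply: continuous_compact => //;
    exact: compact_setX.
move=> /ex_strict_bound_gt0[c c0 Fc]; exists c => // a b Aa Bb.
by apply/ltW/Fc; exists (a, b).
Qed.

Section MixedActions.
Variables (alpha : probability (borel X) R) (beta : probability (borel Y) R).
Hypothesis alphaA : alpha A = 1%E.
Hypothesis betaB : beta B = 1%E.
Local Notation P := ((alpha \x beta)%E).

Lemma actions_measurable : measurable (A `*` B : set (borel X * borel Y)).
Proof. by apply: measurableX; exact: compact_borel. Qed.

Lemma actions_full : P (A `*` B) = 1%E.
Proof.
have mA := compact_borel hausX Acompact.
have mB := compact_borel hausY Bcompact.
rewrite product_measure1E// -[RHS]mule1.
by congr (_ * _)%E; [exact: alphaA|exact: betaB].
Qed.

Lemma payoff_integrable :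
  P.-integrable (A `*` B) (EFin \o (fun ab => F ab.1 ab.2)).
Proof.
apply: measurable_bounded_integrable.
- exact: actions_measurable.
- by rewrite -[ltLHS]/((alpha \x beta)%E (A `*` B)) actions_full ltry.
- exact: payoff_measurable.
have [c c0 Fc] := payoff_bounded.
exists c; split; first exact: num_real.
by move=> r cr [a b]/= [Aa Bb]; apply: le_trans (Fc a b Aa Bb) (ltW cr).
Qed.

Lemma payoff_integral_cst (c : R) :
  \int[P]_(ab in A `*` B) (fun=> c) ab = c.
Proof.
rewrite Rintegral_cst; last exact: actions_measurable.
by rewrite -[fine _]/(fine ((alpha \x beta)%E (A `*` B))) actions_full mulr1.
Qed.

Lemma cst_integrable (c : R) : P.-integrable (A `*` B) (EFin \o cst c).
Proof.
apply: measurable_bounded_integrable.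
- exact: actions_measurable.
- by rewrite -[ltLHS]/((alpha \x beta)%E (A `*` B)) actions_full ltry.
- exact: measurable_cst.
by exists `|c|; split; [exact: num_real|move=> r /ltW cr x _].
Qed.

Lemma payoff_integral_shift (c : R) :
  \int[P]_(ab in A `*` B) (F ab.1 ab.2 + c) =
  \int[P]_(ab in A `*` B) F ab.1 ab.2 + c.
Proof.
rewrite RintegralD; first by rewrite payoff_integral_cst.
- exact: actions_measurable.
- exact: payoff_integrable.
- exact: cst_integrable.
Qed.

End MixedActions.

End CompactPayoff.

(** * Approximate minimax for continuous payoffs *)

Section Tonelli.
Context {R : realType} {X Y : ptopologicalType}.
Variables (A : set X) (B : set Y) (F : X -> Y -> R).
Hypothesis hausX : hausdorff_space X.
Hypothesis hausY : hausdorff_space Y.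
Hypothesis Acompact : compact A.
Hypothesis Bcompact : compact B.
Hypothesis Fcont : {within A `*` B, continuous (fun ab => F ab.1 ab.2)}.
Variables (alpha : probability (borel X) R) (beta : probability (borel Y) R).
Hypothesis alphaA : alpha A = 1%E.
Hypothesis betaB : beta B = 1%E.
Local Notation P := ((alpha \x beta)%E).

Let mA : measurable (A : set (borel X)) := compact_borel hausX Acompact.
Let mB : measurable (B : set (borel Y)) := compact_borel hausY Bcompact.
Let mAB := actions_measurable hausX hausY Acompact Bcompact.

Variable c : R.
Hypothesis Fc : forall a b, A a -> B b -> `|F a b| <= c.

(** The payoff shifted to be nonnegative and extended by zero, so that Tonelli's
    theorem applies to it on the whole product. *)
Definition raised_payoff (ab : borel X * borel Y) : \bar R :=
  ((fun ab => (F ab.1 ab.2 + c)%:E) \_ (A `*` B)) ab.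

Lemma raised_payoff_in a b : A a -> B b ->
  raised_payoff (a, b) = (F a b + c)%:E.
Proof. by move=> Aa Bb; rewrite /raised_payoff patchE mem_set. Qed.

Lemma raised_payoff_outA a b : ~ A a -> raised_payoff (a, b) = 0%E.
Proof. by move=> Aa; rewrite /raised_payoff patchE memNset// => -[]. Qed.

Lemma raised_payoff_outB a b : ~ B b -> raised_payoff (a, b) = 0%E.
Proof. by move=> Bb; rewrite /raised_payoff patchE memNset// => -[]. Qed.

Lemma raised_payoff_ge0 ab : (0 <= raised_payoff ab)%E.
Proof.
rewrite /raised_payoff patchE; case: ifPn => // /set_mem[Aa Bb];
  rewrite lee_fin.
by have := Fc Aa Bb; rewrite ler_norml; lra.
Qed.

Lemma raised_payoff_measurable :
  measurable_fun [set: borel X * borel Y] raised_payoff.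
Proof.
apply/(measurable_restrictT _ mAB)/measurable_EFinP;
  apply: measurable_funD => //.
exact: payoff_measurable.
Qed.

Lemma raised_payoff_integral :
  ((\int[P]_(ab in A `*` B) F ab.1 ab.2 + c)%:E =
    \int[P]_ab raised_payoff ab)%E.
Proof.
have iF := payoff_integrable hausX hausY Acompact Bcompact Fcont alphaA betaB.
have ic := cst_integrable hausX hausY Acompact Bcompact alphaA betaB c.
rewrite -integral_mkcond
  -(payoff_integral_shift hausX hausY Acompact Bcompact Fcont alphaA betaB).
rewrite fineK//; apply: integrable_fin_num => //.
by under [X in integrable _ _ X]funext do rewrite /= EFinD; exact: integrableD.
Qed.

Lemma payoff_mixture_le m (p : 'I_m.+1 -> X) (w : 'I_m.+1 -> R) (r : R) :
  (forall f : borel X -> \bar R, measurable_fun [set: borel X] f ->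
     (forall x, 0 <= f x)%E ->
       (\int[alpha]_x f x = \sum_i (w i)%:E * f (p i))%E) ->
  \sum_i w i = 1 -> (forall i, A (p i)) ->
  (forall b, B b -> \sum_i w i * F (p i) b <= r) ->
  \int[P]_(ab in A `*` B) F ab.1 ab.2 <= r.
Proof.
move=> alphaE w1 pA le_r; rewrite -(lerD2r c) -lee_fin raised_payoff_integral.
rewrite fubini_tonelli2;
  [|exact: raised_payoff_measurable|exact: raised_payoff_ge0].
apply: (@le_trans _ _ (\int[beta]_(b in B) (r + c)%:E)%E); last first.
  by rewrite integral_cst// -[X in (_ * X)%E]/(beta B) betaB mule1.
rewrite [leRHS]integral_mkcond; apply: le_integral_pointwise => b _.
rewrite /fubini_G alphaE; last by move=> a; exact: raised_payoff_ge0.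
- rewrite patchE; case: ifPn => [/set_mem Bb|/negP Bb].
    under eq_bigr => i _ do rewrite raised_payoff_in// -EFinM mulrDr.
    rewrite sumEFin lee_fin big_split/= -mulr_suml w1 mul1r lerD2r.
    exact: le_r.
  rewrite big1// => i _; rewrite raised_payoff_outB ?mule0// => /mem_set.
  exact: Bb.
- exact: (measurable_fun_pair1 _ raised_payoff_measurable).
Qed.

Lemma payoff_mixture_ge m (p : 'I_m.+1 -> Y) (w : 'I_m.+1 -> R) (r : R) :
  (forall f : borel Y -> \bar R, measurable_fun [set: borel Y] f ->
     (forall y, 0 <= f y)%E ->
       (\int[beta]_y f y = \sum_i (w i)%:E * f (p i))%E) ->
  \sum_i w i = 1 -> (forall i, B (p i)) ->
  (forall a, A a -> r <= \sum_i w i * F a (p i)) ->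
  r <= \int[P]_(ab in A `*` B) F ab.1 ab.2.
Proof.
move=> betaE w1 pB ge_r; rewrite -(lerD2r c) -lee_fin raised_payoff_integral.
rewrite fubini_tonelli1;
  [|exact: raised_payoff_measurable|exact: raised_payoff_ge0].
apply: (@le_trans _ _ (\int[alpha]_(a in A) (r + c)%:E)%E).
  by rewrite integral_cst// -[X in (_ * X)%E]/(alpha A) alphaA mule1.
rewrite [leLHS]integral_mkcond; apply: le_integral_pointwise => a _.
rewrite /fubini_F betaE; last by move=> b; exact: raised_payoff_ge0.
- rewrite patchE; case: ifPn => [/set_mem Aa|/negP Aa].
    under eq_bigr => i _ do rewrite raised_payoff_in// -EFinM mulrDr.
    rewrite sumEFin lee_fin big_split/= -mulr_suml w1 mul1r lerD2r.
    exact: ge_r.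
  rewrite big1// => i _; rewrite raised_payoff_outA ?mule0// => /mem_set.
  exact: Aa.
- exact: (measurable_fun_pair2 _ raised_payoff_measurable).
Qed.

End Tonelli.

Section Approachability.
Context {R : realType} {Y : Type}.

(** Blackwell's argument for the nonnegative orthant: weighting the coordinates
    by the current deficits, a reply whose weighted payoff is nonnegative
    increases the squared distance of the running total to the orthant by at
    most the squared length of its payoff vector. *)
Lemma deficit_growth (B : set Y) m (g : Y -> 'I_m.+1 -> R) (c : R) (t : nat) :
  (forall b i, B b -> `|g b i| <= c) ->
  (forall w : 'I_m.+1 -> R, (forall i, 0 <= w i) -> \sum_i w i = 1 ->
     exists2 b, B b & 0 <= \sum_i w i * g b i) ->
  exists2 b : nat -> Y, (forall l, B (b l)) &
    \sum_i (Num.min 0 (\sum_(l < t) g (b l) i)) ^+ 2 <=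
      t%:R * (m.+1%:R * c ^+ 2).
Proof.
move=> gc reply; elim: t => [|t [b Bb IH]].
  have w0 i : 0 <= (i == ord0 :> 'I_m.+1)%:R :> R by exact: ler0n.
  have w1 : \sum_i (i == ord0 :> 'I_m.+1)%:R = 1 :> R.
    by rewrite (bigD1 ord0)//= big1 ?addr0// => i /negbTE ->.
  have [b Bb _] := reply _ w0 w1.
  exists (fun=> b) => //; rewrite mul0r big1// => i _.
  by rewrite big_ord0 minxx expr0n.
pose s i := \sum_(l < t) g (b l) i.
pose neg i := - Num.min 0 (s i).
have neg0 i : 0 <= neg i by rewrite oppr_ge0 ge_min lexx.
have [b' Bb' b'P] : exists2 b', B b' & 0 <= \sum_i neg i * g b' i.
  have [neg_sum0|neg_sum_neq0] := eqVneq (\sum_i neg i) 0.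
    exists (b 0%N) => //; rewrite sumr_ge0// => i _.
    have /eqP := neg_sum0; rewrite psumr_eq0// => /allP/(_ i).
    by rewrite mem_index_enum => /(_ isT)/eqP ->; rewrite mul0r.
  have sum_gt0 : 0 < \sum_i neg i by rewrite lt0r neg_sum_neq0 sumr_ge0.
  have w1 : \sum_i neg i / (\sum_i neg i) = 1 by rewrite -mulr_suml divff.
  have [b' Bb' b'P] := reply (fun i => neg i / \sum_i neg i)
    (fun i => divr_ge0 (neg0 i) (ltW sum_gt0)) w1.
  exists b' => //; rewrite -(pmulr_lge0 _ (_ : 0 < (\sum_i neg i)^-1))
    ?invr_gt0//.
  by rewrite mulr_suml; under eq_bigr do rewrite mulrAC.
exists (fun l => if (l < t)%N then b l else b') => [l|]; first by case: ifP.
have sE i : \sum_(l < t.+1) g (if (l < t)%N then b l else b') i = s i + g b' i.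
  rewrite big_ord_recr/= ltnn; congr (_ + _).
  by apply: eq_bigr => l _; rewrite ltn_ord.
under eq_bigr do rewrite sE.
apply: (@le_trans _ _
  (\sum_i ((Num.min 0 (s i)) ^+ 2 - 2 * (neg i * g b' i) + c ^+ 2))).
  apply: ler_sum => i _.
  have gi2 : g b' i ^+ 2 <= c ^+ 2.
    by rewrite -[g b' i ^+ 2]real_normK ?num_real//
      lerXn2r ?nnegrE ?(le_trans _ (gc b' i Bb')) ?gc.
  (* Adding the reply to the truncated total can only overestimate the new
     deficit. *)
  apply: (@le_trans _ _ ((Num.min 0 (s i) + g b' i) ^+ 2)); last first.
    by rewrite /neg; move: gi2; rewrite !expr2; nra.
  have [|u_neg] := leP 0 (s i + g b' i); first by rewrite expr0n sqr_ge0.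
  rewrite /Num.min; case: ifP => s0; last by [].
  by rewrite add0r; move: u_neg s0; rewrite !expr2; nra.
rewrite big_split/= big_split/= sumrN -mulr_sumr sumr_const card_ord -mulr_natl.
by move: IH b'P; rewrite -/(s _) -[in t.+1%:R]addn1 natrD mulrDl mul1r; lra.
Qed.

(** The distance of the total to the orthant grows like the square root of the
    number of replies, so that of the average vanishes. *)
Lemma approachability (B : set Y) m (g : Y -> 'I_m.+1 -> R) (c e : R) :
  0 < e -> (forall b i, B b -> `|g b i| <= c) ->
  (forall w : 'I_m.+1 -> R, (forall i, 0 <= w i) -> \sum_i w i = 1 ->
     exists2 b, B b & 0 <= \sum_i w i * g b i) ->
  exists (t : nat) (b : 'I_t.+1 -> Y), (forall l, B (b l)) /\
    forall i, - e <= \sum_l t.+1%:R^-1 * g (b l) i.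
Proof.
move=> e0 gc reply; set K := m.+1%:R * c ^+ 2.
have K0 : 0 <= K by rewrite mulr_ge0 ?sqr_ge0.
pose t := Num.truncn (K / e ^+ 2).
have tK : K <= t.+1%:R * e ^+ 2.
  by rewrite -ler_pdivrMr ?exprn_gt0//; apply/ltW/truncnS_gt.
have [b Bb bP] := deficit_growth t.+1 gc reply.
exists t, (fun l => b l); split=> // i; rewrite -mulr_sumr.
rewrite mulrC ler_pdivlMr//; set s := \sum_(l < _) _.
have t0 : 0 < t.+1%:R :> R by [].
have : (Num.min 0 s) ^+ 2 <= (t.+1%:R * e) ^+ 2.
  apply: le_trans (le_trans _ bP) _.
    by rewrite (bigD1 i)//= lerDl sumr_ge0// => l _; rewrite sqr_ge0.
  by rewrite -/K exprMn [in leRHS]expr2 -mulrA ler_pM2l.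
have [s0 _|s0] := leP 0 s.
  by apply: le_trans s0; rewrite mulNr oppr_le0 mulr_ge0// ltW.
rewrite -sqrrN ler_sqr ?nnegrE ?oppr_ge0 ?(ltW s0) ?mulr_ge0 ?(ltW e0)//.
by lra.
Qed.

End Approachability.

Section Minimax.
Context {R : realType} {X Y : ptopologicalType}.
Variables (A : set X) (B : set Y) (F : X -> Y -> R).
Hypothesis hausX : hausdorff_space X.
Hypothesis hausY : hausdorff_space Y.
Hypothesis Acompact : compact A.
Hypothesis Bcompact : compact B.
Hypothesis A_neq0 : A !=set0.
Hypothesis Fcont : {within A `*` B, continuous (fun ab => F ab.1 ab.2)}.

(** The minimizer is restricted to a finite net of actions, against which a
    finite sequence of pure replies approaches the payoff [v] in every
    coordinate; the maximizer then plays the empirical distribution of these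
    replies. *)
Lemma approximate_minimax (v e : R) : 0 < e ->
  (forall alpha : probability (borel X) R, alpha A = 1%E ->
     exists2 beta : probability (borel Y) R, beta B = 1%E &
       v <= \int[(alpha \x beta)%E]_(ab in A `*` B) F ab.1 ab.2) ->
  exists2 beta : probability (borel Y) R, beta B = 1%E &
    forall alpha : probability (borel X) R, alpha A = 1%E ->
      v - e <= \int[(alpha \x beta)%E]_(ab in A `*` B) F ab.1 ab.2.
Proof.
move=> e0 answer; have e3 : 0 < e / 3 by rewrite divr_gt0.
have slack (S : R) : - (e / 3) <= S - (v - e / 3) -> v - e <= S - e / 3 by lra.
have net_close (x y : R) : `|x - y| <= e / 3 -> y - e / 3 <= x.
  by rewrite ler_norml; lra.
have mA : measurable (A : set (borel X)) := compact_borel hausX Acompact.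
have mB : measurable (B : set (borel Y)) := compact_borel hausY Bcompact.
have [c c0 Fc] := payoff_bounded Acompact Bcompact Fcont.
have [s [sA snet]] := payoff_net Acompact Bcompact Fcont e3.
have [a0 Aa0] := A_neq0; have [a1 a1s _] := snet a0 Aa0.
have s_gt0 : (0 < size s)%N by case: (s) a1s.
pose p (i : 'I_(size s).-1.+1) : X := nth a0 s i.
have lt_size (i : 'I_(size s).-1.+1) :
  (i < size s)%N.
  by rewrite -[ltnRHS]prednK.
have pA i : A (p i) by apply: sA; rewrite mem_nth.
pose g b i := F (p i) b - (v - e / 3).
have gc b i : B b -> `|g b i| <= c + `|v - e / 3|.
  by move=> Bb; apply: le_trans (ler_normB _ _) _; rewrite lerD2r Fc.
have [|t [b [bB bP]]] := approachability e3 gc.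
  move=> w w0 w1; apply: contrapT => no.
  have [alpha [alphaD alphaE]] := @finite_mixture _ (borel X) R _ p w w0 w1.
  have alphaA : alpha A = 1%E by exact: alphaD.
  have [beta betaB] := answer alpha alphaA.
  apply/negP; rewrite -ltNge; apply: (@le_lt_trans _ _ (v - e / 3));
    last by lra.
  apply: (payoff_mixture_le (p := p) (w := w) hausX hausY Acompact Bcompact
    Fcont alphaA betaB Fc) => //.
  move=> b Bb; have : ~~ (0 <= \sum_i w i * g b i).
    by apply/negP => pos; apply: no; exists b.
  rewrite -ltNge /g; under eq_bigr do rewrite mulrBr.
  by rewrite sumrB -mulr_suml w1 mul1r subr_lt0 => /ltW.
have w0 (l : 'I_t.+1) : 0 <= t.+1%:R^-1 :> R by rewrite invr_ge0.
have w1 : \sum_(l < t.+1) t.+1%:R^-1 = 1 :> R.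
  by rewrite sumr_const card_ord -(mulr_natl (t.+1%:R^-1)) divff.
have [beta [betaD betaE]] := @finite_mixture _ (borel Y) R _ b _ w0 w1.
have betaB : beta B = 1%E by exact: betaD.
exists beta => // alpha alphaA.
apply: (payoff_mixture_ge (p := b) (w := fun=> t.+1%:R^-1) hausX hausY Acompact
  Bcompact Fcont alphaA betaB Fc) => //.
move=> a Aa; have [a' a's near_a] := snet a Aa.
have pE : p (inord (index a' s)) = a'.
  by rewrite /p inordK ?nth_index// prednK// index_mem.
have := bP (inord (index a' s)); rewrite /g pE.
under eq_bigr do rewrite mulrBr.
rewrite sumrB -mulr_suml w1 mul1r => close.
apply: (@le_trans _ _ (\sum_(l < t.+1) t.+1%:R^-1 * F a' (b l) - e / 3)).
  exact: slack.
have -> : e / 3 = \sum_(l < t.+1) t.+1%:R^-1 * (e / 3).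
  by rewrite -mulr_suml w1 mul1r.
rewrite -sumrB; apply: ler_sum => l _.
rewrite -mulrBr ler_wpM2l ?invr_ge0//.
exact: net_close (interior_subset near_a Aa (b l) (bB l)).
Qed.

End Minimax.

(** * One-stage games and the Shapley operator *)

Section Stage.
Context {R : realType} {n : nat} {X Y : ptopologicalType}.
Variable G : concurrent_game R n X Y.
Implicit Types (v x y z : 'cV[R]_n.+1) (i j : 'I_n.+1).
Local Notation T := (shapley G).

Let hausX : hausdorff_space X := hausdorffA G.
Let hausY : hausdorff_space Y := hausdorffB G.
Let Acompact i : compact (actA G i) := @actA_compact _ _ _ _ G i.
Let Bcompact i : compact (actB G i) := @actB_compact _ _ _ _ G i.

Definition stage_pay v i (a : X) (b : Y) : R :=
  pay G i a b + \sum_j trans G i a b j * v j 0.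

Definition mixed_stage v i (alpha : probability (borel X) R)
    (beta : probability (borel Y) R) : R :=
  \int[(alpha \x beta)%E]_(ab in actA G i `*` actB G i) stage_pay v i ab.1 ab.2.

(** Continuity and linearity of the integral are proved together, one successor
    state at a time, because additivity requires the integrability that
    continuity provides. *)
Lemma stage_pay_partial v i (s : seq 'I_n.+1) :
  {within actA G i `*` actB G i, continuous
     (fun ab => pay G i ab.1 ab.2 +
       \sum_(j <- s) trans G i ab.1 ab.2 j * v j 0)} /\
  forall alpha beta, mixedA G i alpha -> mixedB G i beta ->
    \int[(alpha \x beta)%E]_(ab in actA G i `*` actB G i)
      (pay G i ab.1 ab.2 + \sum_(j <- s) trans G i ab.1 ab.2 j * v j 0) =
    mixed_pay G i alpha beta +
      \sum_(j <- s) mixed_trans G i alpha beta j * v j 0.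
Proof.
elim: s => [|j s [cont intE]].
  split=> [|alpha beta _ _].
    rewrite (_ : (fun ab => _) = (fun ab : X * Y => pay G i ab.1 ab.2)).
      exact: pay_continuous.
    by apply/funext => ab; rewrite big_nil addr0.
  rewrite big_nil addr0; apply: eq_Rintegral => ab _.
  by rewrite big_nil addr0.
have consE ab : pay G i ab.1 ab.2 +
      \sum_(l <- j :: s) trans G i ab.1 ab.2 l * v l 0 =
    (pay G i ab.1 ab.2 + \sum_(j <- s) trans G i ab.1 ab.2 j * v j 0) +
    trans G i ab.1 ab.2 j * v j 0.
  by rewrite big_cons [in RHS]addrAC -addrA.
have tcont : {within actA G i `*` actB G i, continuous
    (fun ab => trans G i ab.1 ab.2 j * v j 0)}.
  apply/subspace_continuousP => ab ABab; apply: cvgM; last exact: cvg_cst.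
  by have /subspace_continuousP := @trans_continuous _ _ _ _ G i j; exact.
split=> [|alpha beta alphaA betaB].
  rewrite (_ : (fun ab => _) = (fun ab : X * Y =>
      (pay G i ab.1 ab.2 + \sum_(j <- s) trans G i ab.1 ab.2 j * v j 0) +
      trans G i ab.1 ab.2 j * v j 0)); last by apply/funext => ab; exact: consE.
  apply/subspace_continuousP => ab ABab; apply: cvgD.
    by move/subspace_continuousP : cont; exact.
  by move/subspace_continuousP : tcont; exact.
under eq_Rintegral do rewrite consE.
have mAB := actions_measurable hausX hausY (@Acompact i) (@Bcompact i).
have ipart := payoff_integrable
  (F := fun a b => pay G i a b + \sum_(j <- s) trans G i a b j * v j 0)
  hausX hausY (@Acompact i) (@Bcompact i) cont alphaA betaB.
have iterm := payoff_integrable (F := fun a b => trans G i a b j * v j 0)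
  hausX hausY (@Acompact i) (@Bcompact i) tcont alphaA betaB.
have itrans := payoff_integrable (F := fun a b => trans G i a b j)
  hausX hausY (@Acompact i) (@Bcompact i) (@trans_continuous _ _ _ _ G i j)
    alphaA betaB.
rewrite [LHS](RintegralD mAB ipart iterm) (RintegralZr _ mAB itrans).
by rewrite [X in X + _]intE// big_cons -addrA; congr (_ + _); exact: addrC.
Qed.

Lemma stage_pay_continuous v i :
  {within actA G i `*` actB G i,
    continuous (fun ab => stage_pay v i ab.1 ab.2)}.
Proof. exact: (stage_pay_partial v i (index_enum _)).1. Qed.

Lemma mixed_stageE v i alpha beta : mixedA G i alpha -> mixedB G i beta ->
  mixed_stage v i alpha beta =
  mixed_pay G i alpha beta + \sum_j mixed_trans G i alpha beta j * v j 0.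
Proof. exact: (stage_pay_partial v i (index_enum _)).2. Qed.

Lemma mixedA_neq0 i : mixedA G i !=set0.
Proof.
have [a Aa] := actA_neq0 G i; exists (dirac (a : borel X)).
by rewrite /mixedA/= diracE mem_set.
Qed.

Lemma mixedB_neq0 i : mixedB G i !=set0.
Proof.
have [b Bb] := actB_neq0 G i; exists (dirac (b : borel Y)).
by rewrite /mixedB/= diracE mem_set.
Qed.

Lemma mixed_stage_bound v i (lo hi : R) alpha beta :
  mixedA G i alpha -> mixedB G i beta ->
  (forall a b, actA G i a -> actB G i b -> lo <= stage_pay v i a b <= hi) ->
  lo <= mixed_stage v i alpha beta <= hi.
Proof.
move=> alphaA betaB bnd.
have mAB := actions_measurable hausX hausY (@Acompact i) (@Bcompact i).
have iF := payoff_integrable hausX hausY (@Acompact i) (@Bcompact i)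
  (@stage_pay_continuous v i) alphaA betaB.
have ic := cst_integrable hausX hausY (@Acompact i) (@Bcompact i) alphaA betaB.
have cE := payoff_integral_cst hausX hausY (@Acompact i) (@Bcompact i) alphaA
  betaB.
apply/andP; split.
  rewrite -[leLHS]cE; apply: (le_Rintegral mAB (ic lo) iF) => -[a b] [Aa Bb].
  by have /andP[] := bnd a b Aa Bb.
rewrite -[leRHS]cE; apply: (le_Rintegral mAB iF (ic hi)) => -[a b] [Aa Bb].
by have /andP[] := bnd a b Aa Bb.
Qed.

Lemma mixed_stage_bounded v i : exists2 c : R, 0 < c &
  forall alpha beta, mixedA G i alpha -> mixedB G i beta ->
    - c <= mixed_stage v i alpha beta <= c.
Proof.
have [c c0 Fc] := payoff_bounded (@Acompact i) (@Bcompact i)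
  (@stage_pay_continuous v i).
exists c => // alpha beta alphaA betaB;
  apply: mixed_stage_bound => // a b Aa Bb.
by rewrite -ler_norml; exact: Fc.
Qed.

Definition best_reply v i (alpha : probability (borel X) R) : R :=
  sup [set mixed_stage v i alpha beta | beta in mixedB G i].

Lemma shapleyE v i : T v i 0 =
  inf [set best_reply v i alpha | alpha in mixedA G i].
Proof.
rewrite mxE; congr inf; apply/seteqP; split=> _ [alpha alphaA <-];
  exists alpha => //;
  congr sup; apply/seteqP; split=> _ [beta betaB <-]; exists beta => //;
  by rewrite mixed_stageE.
Qed.

Lemma best_reply_has_sup v i alpha : mixedA G i alpha ->
  has_sup [set mixed_stage v i alpha beta | beta in mixedB G i].
Proof.
move=> alphaA; have [c c0 bnd] := mixed_stage_bounded v i.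
split; first by have [beta betaB] := mixedB_neq0 i;
  exists (mixed_stage v i alpha beta), beta.
by exists c => _ [beta betaB <-]; have /andP[] := bnd alpha beta alphaA betaB.
Qed.

Lemma mixed_stage_le_best v i alpha beta : mixedA G i alpha ->
  mixedB G i beta ->
  mixed_stage v i alpha beta <= best_reply v i alpha.
Proof.
move=> alphaA betaB; apply: ub_le_sup;
  first exact: (best_reply_has_sup v alphaA).2.
by exists beta.
Qed.

Lemma best_reply_has_inf v i :
  has_inf [set best_reply v i alpha | alpha in mixedA G i].
Proof.
have [c c0 bnd] := mixed_stage_bounded v i.
split; first by have [alpha alphaA] := mixedA_neq0 i;
  exists (best_reply v i alpha), alpha.
exists (- c) => _ [alpha alphaA <-]; have [beta betaB] := mixedB_neq0 i.
apply: le_trans (mixed_stage_le_best v alphaA betaB).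
by have /andP[] := bnd alpha beta alphaA betaB.
Qed.

Lemma shapley_le_best v i alpha : mixedA G i alpha ->
  T v i 0 <= best_reply v i alpha.
Proof.
move=> alphaA; rewrite shapleyE; apply: ge_inf;
  first exact: (best_reply_has_inf v i).2.
by exists alpha.
Qed.

Lemma min_near_optimal v i (delta : R) : 0 < delta ->
  exists2 alpha, mixedA G i alpha & forall beta, mixedB G i beta ->
    mixed_stage v i alpha beta <= T v i 0 + delta.
Proof.
move=> d0; have [_ [alpha alphaA <-]] :=
  inf_adherent d0 (best_reply_has_inf v i).
rewrite -shapleyE => /ltW lt; exists alpha => // beta betaB.
exact: le_trans (mixed_stage_le_best v alphaA betaB) lt.
Qed.

(** The operator is an upper value; that the maximizer can secure it is the
    minimax theorem. *)
Lemma max_near_optimal v i (delta : R) : 0 < delta ->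
  exists2 beta, mixedB G i beta & forall alpha, mixedA G i alpha ->
    T v i 0 - delta <= mixed_stage v i alpha beta.
Proof.
move=> d0; have d2 : 0 < delta / 2 by rewrite divr_gt0.
have [|beta betaB betaP] := approximate_minimax (v := T v i 0 - delta / 2)
    hausX hausY (@Acompact i) (@Bcompact i) (actA_neq0 G i)
    (@stage_pay_continuous v i) d2.
  move=> alpha alphaA.
  have [_ [beta betaB <-] lt] := sup_adherent d2 (best_reply_has_sup v alphaA).
  exists beta => //; apply/ltW/le_lt_trans/lt.
  by rewrite lerD2r; exact: shapley_le_best.
exists beta => // alpha alphaA; have := betaP alpha alphaA.
by rewrite -addrA -opprD -splitr.
Qed.

(** The one-stage games at [x] and [y] differ by the expectation of [x - y]
    after the transition. By compactness this expectation is largest at some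
    pure pair of actions, and its maximum bounds the change of the inf-sup. *)
Lemma shapley_pure x y : exists sigma tau,
  [/\ policyA G sigma, policyB G tau &
    forall i, (T x - T y) i 0 <= (policy_matrix G sigma tau *m (x - y)) i 0].
Proof.
pose diff i a b := stage_pay x i a b - stage_pay y i a b.
have diffE i a b : diff i a b = \sum_j trans G i a b j * (x - y) j 0.
  rewrite /diff /stage_pay opprD addrACA subrr add0r -sumrB.
  by apply: eq_bigr => j _; rewrite !mxE mulrBr.
have /choice[c cP] : forall i, exists c : X * Y,
    (actA G i c.1 /\ actB G i c.2) /\
    forall a b, actA G i a -> actB G i b -> diff i a b <= diff i c.1 c.2.
  move=> i; have [a0 Aa0] := actA_neq0 G i; have [b0 Bb0] := actB_neq0 G i.
  have AB0 : actA G i `*` actB G i !=set0 by exists (a0, b0).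
  have dcont : {within actA G i `*` actB G i,
    continuous (fun ab => diff i ab.1 ab.2)}.
    apply/subspace_continuousP => ab ABab; apply: cvgB.
      by have /subspace_continuousP := @stage_pay_continuous x i; exact.
    by have /subspace_continuousP := @stage_pay_continuous y i; exact.
  have [c cAB cmax] :=
    compact_EVT_max AB0 (compact_setX (@Acompact i) (@Bcompact i)) dcont.
  exists c; split=> [|a b Aa Bb]; first exact: set_mem cAB.
  by apply: (cmax (a, b)); rewrite inE.
exists (fun i => (c i).1), (fun i => (c i).2).
split=> [i|i|i]; [by case: (cP i) => -[]|by case: (cP i) => -[]|].
rewrite [leRHS]mxE; under eq_bigr do rewrite [policy_matrix _ _ _ _ _]mxE.
rewrite -diffE; have [_ cmax] := cP i; set M := diff i _ _ in cmax *.
have stage_le alpha beta : mixedA G i alpha -> mixedB G i beta ->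
    mixed_stage x i alpha beta <= mixed_stage y i alpha beta + M.
  move=> alphaA betaB.
  have mAB := actions_measurable hausX hausY (@Acompact i) (@Bcompact i).
  rewrite -(payoff_integral_shift hausX hausY (@Acompact i) (@Bcompact i)
    (@stage_pay_continuous y i) alphaA betaB).
  have ix := payoff_integrable hausX hausY (@Acompact i) (@Bcompact i)
    (@stage_pay_continuous x i) alphaA betaB.
  have iy := payoff_integrable hausX hausY (@Acompact i) (@Bcompact i)
    (@stage_pay_continuous y i) alphaA betaB.
  have ic := cst_integrable hausX hausY (@Acompact i) (@Bcompact i) alphaA
    betaB M.
  have := integrableD mAB iy ic => iyc.
  apply: (le_Rintegral mAB ix iyc) => -[a b] [Aa Bb] /=.
  by rewrite addrC -lerBlDr; exact: cmax.
have -> : (T x - T y) i 0 =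
  T x i 0 - T y i 0 by rewrite [LHS]mxE [X in _ + X]mxE.
rewrite lerBlDr addrC -lerBlDr [leRHS]shapleyE; apply: lb_le_inf.
  exact: (best_reply_has_inf y i).1.
move=> _ [alpha alphaA <-]; rewrite lerBlDr.
apply: le_trans (shapley_le_best x alphaA) _; apply: ge_sup.
  exact: (best_reply_has_sup x alphaA).1.
move=> _ [beta betaB <-]; apply: le_trans (stage_le _ _ alphaA betaB) _.
by rewrite lerD2r; exact: mixed_stage_le_best.
Qed.

Lemma norm_pay_ge i a b : actA G i a -> actB G i b ->
  `|pay G i a b| <= norm_pay G.
Proof.
move=> Aa Bb; apply: ub_le_sup; last by exists i, a, b.
have /choice[c cP] : forall i, exists c : R, forall a b,
    actA G i a -> actB G i b -> `|pay G i a b| <= c.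
  move=> j; have [c _ Fc] := payoff_bounded (@Acompact j) (@Bcompact j)
    (@pay_continuous _ _ _ _ G j).
  by exists c.
exists (\big[Num.max/0]_j c j) => _ [j [a' [b' [Aa' Bb' ->]]]].
exact: le_trans (cP j a' b' Aa' Bb') (le_bigmax _ c j).
Qed.

Lemma hilbert_shapley0 : hilbert_seminorm (T 0) <= 2 * norm_pay G.
Proof.
have stage0 i a b : actA G i a -> actB G i b ->
    - norm_pay G <= stage_pay 0 i a b <= norm_pay G.
  move=> Aa Bb; rewrite -ler_norml /stage_pay big1 ?addr0 ?norm_pay_ge// => j _.
  by rewrite mxE mulr0.
have mixed0 i alpha beta : mixedA G i alpha -> mixedB G i beta ->
    - norm_pay G <= mixed_stage 0 i alpha beta <= norm_pay G.
  by move=> alphaA betaB; apply: mixed_stage_bound => //; exact: stage0.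
have T0 i : - norm_pay G <= T 0 i 0 <= norm_pay G.
  apply/andP; split.
    rewrite shapleyE; apply: lb_le_inf; first exact: (best_reply_has_inf 0 i).1.
    move=> _ [alpha alphaA <-]; have [beta betaB] := mixedB_neq0 i.
    apply: le_trans (mixed_stage_le_best 0 alphaA betaB).
    by have /andP[] := mixed0 i alpha beta alphaA betaB.
  have [alpha alphaA] := mixedA_neq0 i.
  apply: le_trans (shapley_le_best 0 alphaA) _; apply: ge_sup.
    exact: (best_reply_has_sup 0 alphaA).1.
  by move=> _ [beta betaB <-]; have /andP[] := mixed0 i alpha beta alphaA betaB.
apply/hilbert_leP => i j; have /andP[_ up] := T0 i; have /andP[lo _] := T0 j.
by lra.
Qed.

End Stage.

(** * Expected totals and the value of the game *)

Section Plays.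
Context {R : realType} {n : nat} {X Y : ptopologicalType}.
Variable G : concurrent_game R n X Y.
Implicit Types (v u : 'cV[R]_n.+1) (i j : 'I_n.+1).
Local Notation T := (shapley G).
Local Notation hist k := (@history n X Y k).

Let hausX : hausdorff_space X := hausdorffA G.
Let hausY : hausdorff_space Y := hausdorffB G.
Let Acompact : forall i, compact (actA G i) := @actA_compact _ _ _ _ G.
Let Bcompact : forall i, compact (actB G i) := @actB_compact _ _ _ _ G.

(** Payments are only controlled on the action sets, so estimates on functions
    of the history are confined to these histories, which carry all the
    mass. *)
Definition valid_history k (h : hist k) : Prop :=
  forall s, s \in (h.1 : seq _) -> actA G s.1.1 s.1.2 /\ actB G s.1.1 s.2.

Definition bounded_on_plays k (f : hist k -> R) : Prop :=
  exists c : R, forall h, valid_history h -> `|f h| <= c.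

Lemma history_next_valid k (h : hist k) a b j :
  valid_history h -> actA G h.2 a -> actB G h.2 b ->
  valid_history (history_next h a b j).
Proof.
move=> hv Aa Bb s; rewrite /history_next/= mem_rcons inE => /predU1P[->//|].
exact: hv.
Qed.

Definition one_stage (sigma : strategyA G) (tau : strategyB G) k
    (f : hist k.+1 -> R) (h : hist k) : R :=
  \int[(sigma k h \x tau k h)%E]_(ab in actA G h.2 `*` actB G h.2)
    \sum_j trans G h.2 ab.1 ab.2 j * f (history_next h ab.1 ab.2 j).

Section Expectation.
Variables (sigma : strategyA G) (tau : strategyB G).
Local Notation K := (@one_stage sigma tau _).

Lemma one_stage_le k (f g : hist k.+1 -> R) (c : R) h :
  valid_history h ->
  (forall h', valid_history h' -> - c <= f h' /\ f h' <= g h' /\ g h' <= c) ->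
  K f h <= K g h.
Proof.
move=> hv fg; apply: (@le_Rintegral_pointwise _ _ _ _ _ _ _ c).
- exact: actions_measurable.
- by apply: actions_full => //; [exact: stratA_mixed|exact: stratB_mixed].
move=> [a b] [Aa Bb]/=.
have tr0 j := trans_ge0 j Aa Bb; have tr1 := trans_sum1 Aa Bb.
have next j := fg _ (history_next_valid (j := j) hv Aa Bb).
split; last split.
- rewrite -[leLHS]mul1r -tr1 mulr_suml; apply: ler_sum => j _.
  by rewrite ler_wpM2l//; case: (next j).
- by apply: ler_sum => j _; rewrite ler_wpM2l//; case: (next j) => _ [].
- rewrite -[leRHS]mul1r -tr1 mulr_suml; apply: ler_sum => j _.
  by rewrite ler_wpM2l//; case: (next j) => _ [].
Qed.

Lemma one_stage_cst k (c : R) h : K (fun _ : hist k.+1 => c) h = c.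
Proof.
rewrite /one_stage; transitivity (\int[(sigma k h \x tau k h)%E]_(ab in
    actA G h.2 `*` actB G h.2) (fun=> c) ab); last first.
  by apply: payoff_integral_cst => //;
    [exact: stratA_mixed|exact: stratB_mixed].
apply: eq_Rintegral => -[a b] /set_mem[Aa Bb].
by rewrite -mulr_suml trans_sum1// mul1r.
Qed.

Lemma one_stage_bounded k (f : hist k.+1 -> R) :
  bounded_on_plays f -> bounded_on_plays (K f).
Proof.
move=> [c fc]; exists c => h hv; rewrite ler_norml; apply/andP; split.
  rewrite -[leLHS](one_stage_cst (- c) h);
    apply: (one_stage_le (c := c)) => // h' hv'.
  by have := fc h' hv'; rewrite ler_norml lexx => /andP[? ?].
rewrite -[leRHS](one_stage_cst c h);
  apply: (one_stage_le (c := c)) => // h' hv'.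
by have := fc h' hv'; rewrite ler_norml lexx => /andP[? ?].
Qed.

(** The nested integrals are compared one stage at a time by the monotonicity of
    the integral on arbitrary functions; boundedness keeps them finite. *)
Lemma play_expectation_le i0 k (f g : hist k -> R) :
  bounded_on_plays f -> bounded_on_plays g ->
  (forall h, valid_history h -> f h <= g h) ->
  play_expectation sigma tau i0 f <= play_expectation sigma tau i0 g.
Proof.
elim: k f g => [|k IHk] f g fb gb fg; first exact: fg.
apply: (IHk (K f) (K g)); [exact: one_stage_bounded|exact: one_stage_bounded|].
have [[cf fc] [cg gc]] := (fb, gb) => h hv.
apply: (one_stage_le (c := Num.max cf cg)) => // h' hv'.
have := fc h' hv'; rewrite ler_norml lerNl => /andP[lo _].
have := gc h' hv'; rewrite ler_norml => /andP[_ up].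
by rewrite lerNl !le_max lo up orbT fg.
Qed.

(** The total so far completed by the continuation payoff [u] of the current
    state; the constant [c] absorbs what the past stages have gained. *)
Definition potential u (c : R) k (h : hist k) : R :=
  total_pay G h + (u h.2 0 + c).

Lemma potential_bounded u c k : bounded_on_plays (@potential u c k).
Proof.
exists (k%:R * norm_pay G + (`|u| + `|c|)) => h hv.
apply: le_trans (ler_normD _ _) (lerD _ _); last first.
  by apply: le_trans (ler_normD _ _) _; rewrite lerD2r entry_le_norm.
have -> : k%:R * norm_pay G = \sum_(s <- h.1) norm_pay G.
  by rewrite big_const_seq count_predT size_tuple iter_addr_0 mulr_natl.
apply: le_trans (ler_norm_sum _ _ _) _.
rewrite big_seq [leRHS]big_seq; apply: ler_sum => s /hv[As Bs].
exact: norm_pay_ge.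
Qed.

(** Transition probabilities sum to one, so the past total and the constant pass
    through the stage unchanged; what remains is a one-stage payoff. *)
Lemma one_stage_potential u c k h :
  K (@potential u c k.+1) h =
  total_pay G h + (mixed_stage G u h.2 (sigma k h) (tau k h) + c).
Proof.
rewrite [RHS]addrCA /mixed_stage; set d := total_pay G h + c.
rewrite -(payoff_integral_shift hausX hausY (@Acompact h.2) (@Bcompact h.2)
  (@stage_pay_continuous _ _ _ _ G u h.2) (stratA_mixed sigma h)
    (stratB_mixed tau h)).
apply: eq_Rintegral => -[a b] /set_mem[Aa Bb] /=.
have nextE j : potential u c (history_next h a b j) =
    d + pay G h.2 a b + u j 0.
  rewrite /potential /history_next /total_pay/= -cats1 big_cat big_seq1/= /d.
  by rewrite -[in RHS]/(total_pay G h) /total_pay; ring.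
under eq_bigr do rewrite nextE mulrDr.
by rewrite big_split/= -mulr_suml trans_sum1// mul1r /stage_pay; ring.
Qed.

Lemma play_expectation_potential_le u (rate : R) i0 k c :
  (forall l (h : hist l),
     mixed_stage G u h.2 (sigma l h) (tau l h) <= u h.2 0 + rate) ->
  play_expectation sigma tau i0 (@potential u c k) <= u i0 0 + c + k%:R * rate.
Proof.
move=> step; elim: k c => [|k IHk] c.
  by rewrite /= /potential /total_pay/= big_nil add0r mul0r addr0.
apply: (@le_trans _ _
  (play_expectation sigma tau i0 (@potential u (c + rate) k))).
  apply: (@play_expectation_le i0 k (K (@potential u c k.+1))
    (@potential u (c + rate) k)).
  - by apply: one_stage_bounded; exact: potential_bounded.
  - exact: potential_bounded.
  - move=> h hv; rewrite one_stage_potential /potential lerD2l addrCA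
      [leRHS]addrC.
    by rewrite lerD2r; exact: step.
by apply: le_trans (IHk _) _; rewrite -[in k.+1%:R]addn1 natrD; lra.
Qed.

Lemma play_expectation_potential_ge u (rate : R) i0 k c :
  (forall l (h : hist l),
     u h.2 0 + rate <= mixed_stage G u h.2 (sigma l h) (tau l h)) ->
  u i0 0 + c + k%:R * rate <= play_expectation sigma tau i0 (@potential u c k).
Proof.
move=> step; elim: k c => [|k IHk] c.
  by rewrite /= /potential /total_pay/= big_nil add0r mul0r addr0.
apply: (@le_trans _ _
  (play_expectation sigma tau i0 (@potential u (c + rate) k))).
  by apply: le_trans (IHk _); rewrite -[in k.+1%:R]addn1 natrD; lra.
apply: (@play_expectation_le i0 k (@potential u (c + rate) k)
  (K (@potential u c k.+1))).
- exact: potential_bounded.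
- by apply: one_stage_bounded; exact: potential_bounded.
- move=> h hv; rewrite one_stage_potential /potential lerD2l addrCA
    [leLHS]addrC.
  by rewrite lerD2r; exact: step.
Qed.

(** If the one-stage game with continuation [u] pays at most [rate] more than
    [u], the potential gains at most [rate] per stage, and it differs from the
    total by at most the spread of [u]. *)
Lemma expected_total_le u (rate : R) i0 k :
  (forall l (h : hist l),
     mixed_stage G u h.2 (sigma l h) (tau l h) <= u h.2 0 + rate) ->
  expected_total sigma tau i0 k <= hilbert_seminorm u + k%:R * rate.
Proof.
move=> step; apply: (@le_trans _ _ (play_expectation sigma tau i0
    (@potential u (- bot_entry u) k))).
  apply: play_expectation_le; [|exact: potential_bounded|].
    have [c bc] := potential_bounded 0 0 k; exists c => h /bc.
    by rewrite /potential mxE !addr0.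
  by move=> h _; rewrite /potential lerDl subr_ge0 bot_entry_le.
apply: le_trans (play_expectation_potential_le i0 k (- bot_entry u) step) _.
by rewrite !lerD2r le_top_entry.
Qed.

Lemma expected_total_ge u (rate : R) i0 k :
  (forall l (h : hist l),
     u h.2 0 + rate <= mixed_stage G u h.2 (sigma l h) (tau l h)) ->
  k%:R * rate - hilbert_seminorm u <= expected_total sigma tau i0 k.
Proof.
move=> step; apply: (@le_trans _ _ (play_expectation sigma tau i0
    (@potential u (- top_entry u) k))); last first.
  apply: play_expectation_le; [exact: potential_bounded| |].
    have [c bc] := potential_bounded 0 0 k; exists c => h /bc.
    by rewrite /potential mxE !addr0.
  by move=> h _; rewrite /potential gerDl subr_le0 le_top_entry.
apply: le_trans (play_expectation_potential_ge i0 k (- top_entry u) step).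
rewrite addrC lerD2r /hilbert_seminorm opprB lerD2r.
exact: bot_entry_le.
Qed.

End Expectation.

Section Stationary.
Variables (alpha : 'I_n.+1 -> probability (borel X) R).
Variables (beta : 'I_n.+1 -> probability (borel Y) R).
Hypothesis alphaA : forall i, mixedA G i (alpha i).
Hypothesis betaB : forall i, mixedB G i (beta i).

Let alpha_measurable k : measurable_fun [set: hist k]
  ((fun h => alpha h.2) : hist k -> pprobability (borel X) R).
Proof.
apply: (@measurableT_comp _ _ _ _ _ _
  (alpha : 'I_n.+1 -> pprobability (borel X) R)) => //.
Qed.

Let beta_measurable k : measurable_fun [set: hist k]
  ((fun h => beta h.2) : hist k -> pprobability (borel Y) R).
Proof.
apply: (@measurableT_comp _ _ _ _ _ _
  (beta : 'I_n.+1 -> pprobability (borel Y) R)) => //.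
Qed.

Definition stationaryA : strategyA G :=
  StrategyA alpha_measurable (fun k h => alphaA h.2).

Definition stationaryB : strategyB G :=
  StrategyB beta_measurable (fun k h => betaB h.2).

End Stationary.

Lemma limn_esup_le_near (u : nat -> R) (l : R) :
  (\forall N \near \oo, u N <= l) ->
  (limn_esup (fun N => (u N)%:E) <= l%:E)%E.
Proof.
move=> ul; apply: ereal_inf_le;
  exists (ereal_sup [set (u N)%:E | N in [set N | u N <= l]]).
  by exists [set N | u N <= l].
by apply: ge_ereal_sup => _ [N /= uN <-]; rewrite lee_fin.
Qed.

Lemma average_le_near (u : nat -> R) (c rate e : R) : 0 < e -> 0 <= c ->
  (forall N, u N <= c + N%:R * rate) ->
  \forall N \near \oo, u N / N%:R <= rate + e.
Proof.
move=> e0 c0 ub; near=> N.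
have N0 : 0 < N%:R :> R by rewrite ltr0n; near: N; exact: nbhs_infty_gt.
rewrite ler_pdivrMr// mulrDl; apply: le_trans (ub N) _.
rewrite addrC [rate * _]mulrC lerD2l -ler_pdivrMl//.
by near: N; exact: nbhs_infty_ger.
Unshelve. all: by end_near. Qed.

(** Near-optimal actions of the one-stage game with continuation payoffs [u]
    gain at every stage what the operator adds to [u]; when [u] is shifted by
    almost the same amount in every state, playing them forever secures that
    amount. *)
Lemma has_value_of_approximate_shift (lambda : R) :
  (forall e : R, 0 < e -> exists u, forall i,
     `|T u i 0 - u i 0 - lambda| <= e) ->
  has_value G (const_mx lambda).
Proof.
move=> shift delta d0; have d4 : 0 < delta / 4 by rewrite divr_gt0.
have d2 : 0 < delta / 2 by rewrite divr_gt0.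
have [u uP] := shift _ d4.
have /choice[alpha alphaP] : forall i, exists alpha, mixedA G i alpha /\
    forall beta, mixedB G i beta -> mixed_stage G u i alpha beta <=
      T u i 0 + delta / 4.
  by move=> i; have [alpha] := min_near_optimal G u i d4; exists alpha.
have /choice[beta betaP] : forall i, exists beta, mixedB G i beta /\
    forall alpha, mixedA G i alpha -> T u i 0 - delta / 4 <=
      mixed_stage G u i alpha beta.
  by move=> i; have [beta] := max_near_optimal G u i d4; exists beta.
exists (stationaryA (fun i => (alphaP i).1)),
  (stationaryB (fun i => (betaP i).1)).
move=> sigma tau i; rewrite mxE; split.
  have up l (h : hist l) : mixed_stage G u h.2 (alpha h.2) (tau l h) <=
      u h.2 0 + (lambda + delta / 2).
    have := (alphaP h.2).2 _ (stratB_mixed tau h); have := uP h.2.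
    by rewrite ler_norml => /andP[? ?]; lra.
  have := limn_esup_le_near (average_le_near d2 (hilbert_ge0 u)
    (fun N => expected_total_le (sigma := stationaryA (fun i => (alphaP i).1))
      i N up)).
  rewrite -/(chi_sup _ _ _) => le.
  apply: (@le_trans _ _ (- delta%:E + (lambda + delta / 2 + delta / 2)%:E)%E).
    by rewrite leeD2l.
  by rewrite -EFinN -EFinD lee_fin; lra.
have lo l (h : hist l) : u h.2 0 + (lambda - delta / 2) <=
    mixed_stage G u h.2 (sigma l h) (beta h.2).
  have := (betaP h.2).2 _ (stratA_mixed sigma h); have := uP h.2.
  by rewrite ler_norml => /andP[? ?]; lra.
have ge N : - expected_total sigma (stationaryB (fun i => (betaP i).1)) i N <=
    hilbert_seminorm u + N%:R * - (lambda - delta / 2).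
  have := expected_total_ge (tau := stationaryB (fun i => (betaP i).1)) i N lo.
  by rewrite mulrN; lra.
have := limn_esup_le_near (average_le_near d2 (hilbert_ge0 u) ge).
rewrite /chi_inf /limn_einf => le.
rewrite [X in limn_esup X](_ : _ = (fun N => ((- expected_total sigma
    (stationaryB (fun i => (betaP i).1)) i N) / N%:R)%:E)); last first.
  by apply/funext => N; rewrite mulNr.
apply: (@le_trans _ _ (- (- (lambda - delta / 2) + delta / 2)%:E + delta%:E)%E).
  by rewrite -EFinN -EFinD lee_fin; lra.
by rewrite leeD2r// leeN2.
Qed.

End Plays.

(** * Counting the iterations *)

Section Counting.
Context {R : realType}.
Implicit Types (t y theta : R).

Lemma geometric_le (t y : R) (J : nat) :
  0 < t <= 1 -> 0 < y -> - ln y <= J%:R * t -> (1 - t) ^+ J <= y.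
Proof.
move=> /andP[t0 t1] y0 Jt; have t1' : 0 <= 1 - t by rewrite subr_ge0.
apply: (@le_trans _ _ (expR (- t) ^+ J)).
  by rewrite lerXn2r ?nnegrE ?expR_ge0// expR_ge1Dx.
rewrite -expRM_natl -[leRHS]lnK ?posrE// ler_expR.
by move: Jt; rewrite lerNl mulrN.
Qed.

Lemma geometric_small (t y : R) : 0 < t <= 1 -> 0 < y ->
  exists J : nat, (1 - t) ^+ J <= y.
Proof.
move=> t01 y0; have /andP[t0 t1] := t01.
exists (Num.truncn (- ln y / t)).+1; apply: geometric_le => //.
by rewrite -ler_pdivrMr//; apply/ltW/truncnS_gt.
Qed.

(** Rounding the number of blocks up to an integer costs at most one block,
    which is paid for by the term [`|ln (1 - theta)|] because this is at least
    [theta]. *)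
Lemma rounding_slack (theta : R) k : (0 < k)%N -> 0 < theta < 1 ->
  1 <= `|ln (1 - theta)| * theta ^- k.
Proof.
move=> k0 /andP[th0 th1]; have th1' : 0 < 1 - theta by rewrite subr_gt0.
have lnle : theta <= `|ln (1 - theta)|.
  have : ln (1 - theta) <= - theta.
    rewrite -[leRHS]expRK ler_ln ?posrE ?expR_gt0//; exact: expR_ge1Dx.
  move=> le; have ln0 : ln (1 - theta) <= 0.
    by apply: le_trans le _; rewrite oppr_le0 ltW.
  by rewrite (ler0_norm ln0) lerNr.
rewrite ler_pdivlMr ?exprn_gt0// mul1r; apply: le_trans lnle.
by case: k k0 => // k _; rewrite exprS ger_pMr// exprn_ile1// ltW.
Qed.

End Counting.

Theorem corollary20 (R : realType) (n : nat) (X Y : ptopologicalType)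
    (G : concurrent_game R n X Y) (pmin epsilon eta : R) (k : nat)
    (oracle : 'cV[R]_n.+1 -> 'cV[R]_n.+1) :
  let theta := pmin / (1 + pmin) in
  let T_theta := fun x => theta *: x + (1 - theta) *: shapley G x in
  let epsilon' := (1 - theta) * epsilon in
  unichain_game G ->
  is_pmin G pmin ->
  is_unichain_index G theta k ->
  0 < epsilon < 1 ->
  0 < eta ->
  eta * (12 + 24 * k%:R * theta ^- k) <= epsilon' ->
  (forall x, `|oracle x - T_theta x| <= eta) ->
  exists (lambda : R) (N : nat) (x : 'cV[R]_n.+1) (alpha beta : R),
    has_value G (const_mx lambda) /\
    rvi_returns oracle epsilon' N x alpha beta /\
    N%:R <= Num.max 1
      ((`|ln epsilon| + `|ln (1 - theta)| + ln 12 + ln (norm_pay G))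
       * k%:R * theta ^- k) /\
    (1 - theta)^-1 * (alpha - epsilon' / 3) <= lambda
      <= (1 - theta)^-1 * (beta + epsilon' / 3) /\
    (1 - theta)^-1 * (beta + epsilon' / 3)
      - (1 - theta)^-1 * (alpha - epsilon' / 3) <= epsilon.
Proof.
move=> theta S epsilon' _ pminP [cc _] /andP[eps0 eps1] eta0 eta_small oracleP.
have [[p0 [i1 [i2 [a [b [i12 Aa Bb _]]]]]] _] := pminP.
have p1 : 0 < 1 + pmin by rewrite addr_gt0.
have th0 : 0 < theta by rewrite divr_gt0.
have th1E : 1 - theta = (1 + pmin)^-1 by rewrite /theta; field;
  rewrite lt0r_neq0.
have th1' : 0 < 1 - theta by rewrite th1E invr_gt0.
have th1 : theta < 1 by rewrite -subr_gt0.
have th01 : 0 < theta < 1 by rewrite th0 th1.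
have k0 : (0 < k)%N := common_column_gt0 i12 cc.
have t0 : 0 < theta ^+ k by rewrite exprn_gt0.
have t01 : 0 < theta ^+ k <= 1 by rewrite t0 exprn_ile1 ?ltW.
pose gamma := 1 - theta ^+ k.
have gamma01 : 0 <= gamma < 1.
  by rewrite /gamma subr_ge0 gtrBl t0 andbT; case/andP: t01.
have S_nonexp x y : hilbert_seminorm (S x - S y) <= hilbert_seminorm (x - y).
  exact: (damped_nonexpansive th01 (shapley_pure G)).
have S_contr x y : hilbert_seminorm (iter k S x - iter k S y) <=
    gamma * hilbert_seminorm (x - y).
  apply: (damped_contraction th01 (shapley_pure G)) cc.
  by move=> s t i j; exact: pmin_lazy_matrix.
have SE x : S x - x = (1 - theta) *: (shapley G x - x).
  rewrite /S; move: (shapley G x) => y.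
  by apply/matrixP => i j; rewrite !mxE; ring.
have rate_bounds x : bot_entry (shapley G x - x) <= escape_rate (shapley G) <=
    top_entry (shapley G x - x).
  exact: (escape_rate_bounds (shapley_pure G)).
have entry_rate x i : `|(shapley G x - x) i 0 - escape_rate (shapley G)| <=
    (1 - theta)^-1 * hilbert_seminorm (x - S x).
  rewrite -hilbertN opprB SE hilbertZ ?(ltW th1')// mulKf ?gt_eqF//.
  have /andP[lo up] := rate_bounds x; rewrite /hilbert_seminorm ler_norml.
  have := bot_entry_le (shapley G x - x) i.
  have := le_top_entry (shapley G x - x) i.
  by lra.
have value : has_value G (const_mx (escape_rate (shapley G))).
  apply: has_value_of_approximate_shift => e e0.
  pose c := hilbert_seminorm (S 0) + 1.
  have c0 : 0 < c by rewrite ltr_wpDl ?hilbert_ge0.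
  have y0 : 0 < (1 - theta) * e / c by rewrite divr_gt0// mulr_gt0.
  have [J Jsmall] := geometric_small t01 y0.
  have exactP x : `|S x - S x| <= 0 by rewrite subrr normr0.
  have := rvi_residual S_nonexp S_contr gamma01 k0 exactP (J * k).
  set x := rvi_iterate _ _; rewrite mul0r add0r mulnK// => res.
  exists x => i; have := entry_rate x i.
  rewrite [X in `|X - _|]mxE [X in `|_ + X - _|]mxE => /le_trans; apply.
  rewrite mulrC ler_pdivrMr// mulrC; apply: le_trans res _.
  apply: (@le_trans _ _ ((1 - theta) * e / c * c));
    last by rewrite divfK ?gt_eqF.
  by rewrite ler_pM ?exprn_ge0 ?hilbert_ge0//;
    [case/andP: gamma01|rewrite lerDl].
have r0 : 0 <= norm_pay G by apply: le_trans (norm_pay_ge Aa Bb).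
have qS0 : hilbert_seminorm (S 0) <= (1 - theta) * (2 * norm_pay G).
  by rewrite /S scaler0 add0r hilbertZ ?(ltW th1')// ler_pM2l//
    hilbert_shapley0.
have eps'0 : 0 < epsilon' by rewrite mulr_gt0.
(* The oracle errors use half of the tolerance epsilon' / 3, the geometric
   decay of the initial increment has to fit in the other half. *)
have stopP m : 12 * norm_pay G * gamma ^+ (m %/ k) <= epsilon ->
    rvi_stop oracle epsilon' (rvi_iterate oracle m).
  move=> small; rewrite /rvi_stop.
  apply: le_trans (rvi_residual S_nonexp S_contr gamma01 k0 oracleP m) _.
  have -> : 1 - gamma = theta ^+ k by rewrite /gamma opprB addrC subrK.
  have g0 : 0 <= gamma ^+ (m %/ k) by rewrite exprn_ge0//; case/andP: gamma01.
  have half : gamma ^+ (m %/ k) * hilbert_seminorm (S 0) <= epsilon' / 6.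
    apply: le_trans (ler_wpM2l g0 qS0) _.
    rewrite mulrCA -mulrA ler_pM2l//.
    by move: small; set g := gamma ^+ _; lra.
  by move: eta_small half; set q := gamma ^+ _ * _; set w := theta ^- k; lra.
pose L := `|ln epsilon| + ln 12 + ln (norm_pay G).
pose bound := (`|ln epsilon| + `|ln (1 - theta)| + ln 12 + ln (norm_pay G))
  * k%:R * theta ^- k.
have [M [M0 Mstop Mbound]] : exists M : nat, [/\ (0 < M)%N,
    rvi_stop oracle epsilon' (rvi_iterate oracle M) & M%:R <= Num.max 1 bound].
  have [r_small|r_large] := leP (12 * norm_pay G) epsilon.
    exists 1%N; split => //; last by rewrite le_max lexx.
    apply: stopP; apply: le_trans r_small;
      rewrite -[leRHS]mulr1 ler_wpM2l ?mulr_ge0//.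
    by rewrite exprn_ile1//; case/andP: gamma01 => // _ /ltW.
  have r12 : 0 < 12 * norm_pay G by apply: lt_trans r_large.
  have r_gt0 : 0 < norm_pay G by rewrite pmulr_rgt0 in r12.
  have LE : - ln (epsilon / (12 * norm_pay G)) = L.
    rewrite ln_div ?posrE// lnM ?posrE// /L ler0_norm;
      last by rewrite ln_le0// ltW.
    by ring.
  have L0 : 0 <= L.
    by rewrite -LE oppr_ge0 ln_le0// ler_pdivrMr// mul1r ltW.
  pose J := (Num.truncn (L * theta ^- k)).+1.
  have Llt : L * theta ^- k < J%:R by exact: truncnS_gt.
  exists (J * k)%N; split; first by rewrite muln_gt0 k0.
    apply: stopP; rewrite mulnK// -ler_pdivlMl// mulrC.
    apply: geometric_le => //; first by rewrite divr_gt0.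
    by rewrite LE -ler_pdivrMr//; exact: ltW.
  rewrite le_max; apply/orP; right.
  have -> : bound = (L * theta ^- k + `|ln (1 - theta)| * theta ^- k) * k%:R.
    by rewrite /bound /L; ring.
  rewrite natrM ler_pM2r ?ltr0n// /J -[in X in X <= _]addn1 natrD.
  by rewrite lerD ?rounding_slack// truncn_le mulr_ge0// invr_ge0 (ltW t0).
have stopping : exists N, (0 < N)%N &&
  rvi_stop oracle epsilon' (rvi_iterate oracle N).
  by exists M; rewrite M0.
have [N /andP[N0 Nstop] Nmin] := ex_minnP stopping.
set x := rvi_iterate oracle N in Nstop.
exists (escape_rate (shapley G)), N, x, (bot_entry (oracle x - x)),
  (top_entry (oracle x - x)).
have eta3 : eta <= epsilon' / 3.
  have : 0 <= eta * (24 * k%:R * theta ^- k).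
    by rewrite !mulr_ge0 ?(ltW eta0)// invr_ge0 (ltW t0).
  by move: eta_small; rewrite mulrDr; set w := eta * (24 * _ * _); lra.
have close i : `|(oracle x - x) i 0 - (1 - theta) * (shapley G x - x) i 0| <=
  eta.
  have -> : (oracle x - x) i 0 - (1 - theta) * (shapley G x - x) i 0 =
      (oracle x - S x) i 0.
    by rewrite /S; move: (shapley G x) (oracle x) => y z; rewrite !mxE; ring.
  by apply: le_trans (oracleP x); exact: entry_le_norm.
split=> //; split; [split=> //|split; [|split]].
- by move=> m /andP[m0 mN]; apply/negP => ms; have := Nmin m;
    rewrite m0 ms leqNgt mN => /(_ isT).
- by apply: le_trans Mbound; rewrite ler_nat Nmin// M0.
- have /andP[lo up] := rate_bounds x; apply/andP; split.
    apply: le_trans lo; rewrite mulrC ler_pdivrMr// mulrC.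
    have [i <-] := bot_entry_attained (shapley G x - x).
    have := bot_entry_le (oracle x - x) i; have := close i.
    by rewrite ler_norml => /andP[_ ?] ?; lra.
  apply: (le_trans up); rewrite mulrC ler_pdivlMr// mulrC.
  have [i <-] := top_entry_attained (shapley G x - x).
  have := le_top_entry (oracle x - x) i; have := close i.
  by rewrite ler_norml => /andP[? _] ?; lra.
- rewrite -mulrBr mulrC ler_pdivrMr// [epsilon * _]mulrC -/epsilon'.
  move: Nstop; rewrite /rvi_stop -hilbertN opprB /hilbert_seminorm.
  by lra.
Qed.
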